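(* Let $R>r\ge1$ and let $f,g:\mathbb{D}_{R}\to\mathbb{C}$ be analytic in $\mathbb{D}_{R}=\{z\in\mathbb{C}:|z|<R\}$, $f(z)=\sum_{k=0}^{\infty}a_{k}z^{k}$, $g(z)=\sum_{k=0}^{\infty}b_{k}z^{k}$. Then there is a constant $C(r,f,g)$, independent of $n$, such that for all $n\in\mathbb{N}$ and all $|z|\le r$, $$\left|U_{n}(fg)(z)-U_{n}(f)(z)U_{n}(g)(z)-\frac{2z(1-z)f'(z)g'(z)}{n}\right|\le\frac{C(r,f,g)}{n^{2}}.$$
   Context: The complex genuine Bernstein-Durrmeyer polynomials of a function $h$ continuous on $[0,1]$ are $$U_{n}(h)(z)=(n-1)\sum_{k=1}^{n-1}\Big(\int_{0}^{1}h(t)p_{n-2,k-1}(t)\,dt\Big)p_{n,k}(z)+(1-z)^{n}h(0)+z^{n}h(1),\quad z\in\mathbb{C},$$ where $p_{n,k}(z)=\binom{n}{k}z^{k}(1-z)^{n-k}$. *)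

(* Defs.v *)
From Stdlib Require Import Reals.
From Coquelicot Require Import Coquelicot.
Open Scope C_scope.

Fixpoint cpow (z : C) (n : nat) : C :=
  match n with O => 1 | S m => z * cpow z m end.

Definition pnk (n k : nat) (z : C) : C :=
  RtoC (Binomial.C n k) * cpow z k * cpow (1 - z) (n - k).

Definition cint01 (u : R -> C) : C := @RInt C_R_CompleteNormedModule u 0%R 1%R.

(* genuine Bernstein-Durrmeyer polynomial U_n(h)(z), n >= 1;
   the sum is over k = 1, ..., n-1 (empty when n = 1) *)
Definition U (n : nat) (h : C -> C) (z : C) : C :=
  RtoC (INR n - 1) *
    sum_n_m (G := C_AbelianGroup)
      (fun k => cint01 (fun t => h (RtoC t) * pnk (n - 2) (k - 1) (RtoC t)) * pnk n k z)
      1 (n - 1)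
  + cpow (1 - z) n * h 0 + cpow z n * h 1.

(* Main.v *)
Require Import Defs.
From Stdlib Require Import Reals Lra Lia Factorial FunctionalExtensionality.
From Coquelicot Require Import Coquelicot.
Open Scope C_scope.

(** Beta integrals give [U_n(e_p) = sum_k p_{n,k} (k)_p / (n)_p] for the monomial
    [e_p(z) = z^p], with rising factorials.  Expanding [(k)_p] one factor at a time
    in falling factorials of [k], whose Bernstein polynomials are explicit, shows
    that [U_n(e_p)(z) = E[z^J]], where [J] is the position after [p] steps of a
    random walk from 0 that moves from [j] to [j + 1] at time [q] with probability
    [(n - j) / (n + q)] and otherwise stays.  Staying has probability at most
    [2 q / n], so for [|z| <= r], with [r >= 1], conditioning on the first step gives
    [U_n(e_p) = z^p + p (p - 1) (z^(p-1) - z^p) / n + O(p^4 r^p / n^2)]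
    uniformly in [n] and [p].  Since
    [(j + k) (j + k - 1) - j (j - 1) - k (k - 1) = 2 j k], the error in the theorem
    for [f = e_j], [g = e_k] is [O((1 + j)^4 (1 + k)^4 r^(j+k) / n^2)].  It is bilinear
    in [(f, g)], hence uniformly bounded for the partial sums of the power series,
    and the theorem follows by passing to the limit. *)

(** * Finite complex sums and powers *)

Fixpoint Csum (x : nat -> C) (n : nat) : C :=
  match n with O => x O | S m => Csum x m + x (S m) end.

Lemma Csum_ext (x y : nat -> C) (n : nat) :
  (forall k, (k <= n)%nat -> x k = y k) -> Csum x n = Csum y n.
Proof.
  induction n as [|n IH]; simpl; intros H.
  - now apply H.
  - rewrite IH, H; auto.
Qed.

Lemma Csum_plus (x y : nat -> C) (n : nat) :
  Csum (fun k => x k + y k) n = Csum x n + Csum y n.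
Proof.
  induction n as [|n IH]; simpl; [reflexivity|]. rewrite IH. ring.
Qed.

Lemma Csum_mult_l (c : C) (x : nat -> C) (n : nat) :
  Csum (fun k => c * x k) n = c * Csum x n.
Proof.
  induction n as [|n IH]; simpl; [reflexivity|]. rewrite IH. ring.
Qed.

Lemma Csum_split_first (x : nat -> C) (n : nat) :
  Csum x (S n) = x O + Csum (fun k => x (S k)) n.
Proof.
  induction n as [|n IH]; [reflexivity|].
  change (Csum x (S (S n))) with (Csum x (S n) + x (S (S n))).
  rewrite IH. simpl. ring.
Qed.

Lemma Csum_mult (x y : nat -> C) (n : nat) :
  Csum x n * Csum y n = Csum (fun j => Csum (fun k => x j * y k) n) n.
Proof.
  rewrite Cmult_comm, <- Csum_mult_l. apply Csum_ext; intros j _.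
  rewrite Csum_mult_l. ring.
Qed.

Lemma Csum_sum_n (x : nat -> C) (n : nat) :
  sum_n (G := C_AbelianGroup) x n = Csum x n.
Proof.
  induction n as [|n IH].
  - rewrite sum_O. reflexivity.
  - rewrite sum_Sn, IH. reflexivity.
Qed.

Lemma Cmod_Csum_le (x : nat -> C) (y : nat -> R) (n : nat) :
  (forall k, (k <= n)%nat -> (Cmod (x k) <= y k)%R) ->
  (Cmod (Csum x n) <= sum_f_R0 y n)%R.
Proof.
  induction n as [|n IH]; simpl; intros H; [now apply H|].
  eapply Rle_trans; [apply Cmod_triangle|].
  apply Rplus_le_compat; auto.
Qed.

Lemma Cmod_cpow (z : C) (n : nat) : Cmod (cpow z n) = (Cmod z ^ n)%R.
Proof.
  induction n as [|n IH]; simpl; [apply Cmod_1|].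
  now rewrite Cmod_mult, IH.
Qed.

Lemma Cmod_cpow_le (z : C) (r : R) (i n : nat) :
  (1 <= r)%R -> (Cmod z <= r)%R -> (i <= n)%nat -> (Cmod (cpow z i) <= r ^ n)%R.
Proof.
  intros Hr Hz Hi. rewrite Cmod_cpow.
  apply Rle_trans with (r ^ i)%R.
  - apply pow_incr. split; [apply Cmod_ge_0|exact Hz].
  - now apply Rle_pow.
Qed.

Lemma cpow_add (z : C) (i j : nat) : cpow z (i + j) = cpow z i * cpow z j.
Proof. induction i as [|i IH]; simpl; [ring|]. rewrite IH. ring. Qed.

Lemma cpow_RtoC (x : R) (n : nat) : cpow (RtoC x) n = RtoC (x ^ n).
Proof. induction n as [|n IH]; simpl; [reflexivity|]. now rewrite IH, RtoC_mult. Qed.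

(** * Bernstein basis and Bernstein sums *)

(* [pnk n k] for [k <= n], and 0 beyond: unlike [Binomial.C n k], which is a
   junk value for [k > n], this satisfies Pascal's rule for all [k]. *)
Fixpoint bern (n k : nat) (z : C) : C :=
  match n, k with
  | O, O => 1
  | O, S _ => 0
  | S n', O => (1 - z) * bern n' O z
  | S n', S k' => z * bern n' k' z + (1 - z) * bern n' (S k') z
  end.

Lemma bern_gt (n k : nat) (z : C) : (n < k)%nat -> bern n k z = 0.
Proof.
  revert k; induction n as [|n IH]; intros [|k] H; try lia; simpl; [reflexivity|].
  rewrite !IH by lia. ring.
Qed.

Lemma C_n_0 (n : nat) : Binomial.C n 0 = 1%R.
Proof.
  unfold Binomial.C. rewrite Nat.sub_0_r. simpl. field. apply INR_fact_neq_0.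
Qed.

Lemma C_n_n (n : nat) : Binomial.C n n = 1%R.
Proof.
  unfold Binomial.C. rewrite Nat.sub_diag. simpl. field. apply INR_fact_neq_0.
Qed.

Lemma pnk_bern (n k : nat) (z : C) : (k <= n)%nat -> pnk n k z = bern n k z.
Proof.
  revert k; induction n as [|n IH]; intros k Hk.
  - assert (k = O) by lia; subst. unfold pnk. rewrite C_n_0. simpl. ring.
  - destruct k as [|k].
    + simpl. rewrite <- IH by lia. unfold pnk. rewrite !C_n_0, !Nat.sub_0_r. simpl. ring.
    + simpl. rewrite <- IH by lia.
      destruct (Nat.eq_dec k n) as [->|Hn].
      * rewrite bern_gt by lia. unfold pnk. rewrite !C_n_n, !Nat.sub_diag. simpl. ring.
      * rewrite <- IH by lia. unfold pnk.
        rewrite <- pascal, RtoC_plus by lia.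
        replace (S n - S k)%nat with (S (n - S k)) by lia.
        replace (n - k)%nat with (S (n - S k)) by lia. simpl. ring.
Qed.

Definition bernstein (n : nat) (phi : nat -> R) (z : C) : C :=
  Csum (fun k => bern n k z * RtoC (phi k)) n.

Lemma bernstein_S (n : nat) (phi : nat -> R) (z : C) :
  bernstein (S n) phi z =
  z * bernstein n (fun k => phi (S k)) z + (1 - z) * bernstein n phi z.
Proof.
  (* The added term [k = S n] vanishes by [bern_gt]; with it, all sums run up to [S n] and split in
     the same way. *)
  assert (E : bernstein n phi z = Csum (fun k => bern n k z * RtoC (phi k)) (S n)).
  { simpl. rewrite bern_gt by lia. unfold bernstein. ring. }
  rewrite E. unfold bernstein. rewrite !Csum_split_first.
  rewrite Cmult_plus_distr_l, <- !Csum_mult_l.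
  rewrite (Csum_ext _ (fun k => z * (bern n k z * RtoC (phi (S k)))
     + (1 - z) * (bern n (S k) z * RtoC (phi (S k))))).
  - rewrite Csum_plus. simpl. ring.
  - intros k _. simpl. ring.
Qed.

Lemma bernstein_ext (n : nat) (phi psi : nat -> R) (z : C) :
  (forall k, phi k = psi k) -> bernstein n phi z = bernstein n psi z.
Proof. intros H. apply Csum_ext. intros k _. now rewrite H. Qed.

Lemma bernstein_lin (n : nat) (c d : R) (phi psi : nat -> R) (z : C) :
  bernstein n (fun k => c * phi k + d * psi k)%R z =
  c * bernstein n phi z + d * bernstein n psi z.
Proof.
  unfold bernstein. rewrite <- !Csum_mult_l, <- Csum_plus. apply Csum_ext.
  intros k _. rewrite RtoC_plus, !RtoC_mult. ring.
Qed.

(** * Factorial moments and the random walk *)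

Fixpoint falling (x : R) (j : nat) : R :=
  match j with O => 1 | S i => falling x i * (x - INR i) end.

Fixpoint rising (x : R) (m : nat) : R :=
  match m with O => 1 | S i => x * rising (x + 1) i end.

Lemma falling_shift (x : R) (j : nat) :
  falling (x + 1) (S j) = ((x + 1) * falling x j)%R.
Proof.
  induction j as [|j IH]; [simpl; ring|].
  change (falling (x + 1) (S (S j))) with (falling (x + 1) (S j) * (x + 1 - INR (S j)))%R.
  rewrite IH, S_INR. simpl. ring.
Qed.

Lemma falling_succ (x : R) (j : nat) :
  falling (x + 1) (S j) = (falling x (S j) + INR (S j) * falling x j)%R.
Proof. rewrite falling_shift, S_INR. simpl. ring. Qed.

(** These are the factorial moments of the binomial law. In the induction on [n], the difference
    rule [falling_succ] matches the Pascal recursion [bernstein_S]. *)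
Lemma bernstein_falling (n j : nat) (z : C) :
  bernstein n (fun k => falling (INR k) j) z = falling (INR n) j * cpow z j.
Proof.
  revert j; induction n as [|n IH]; intros j.
  - unfold bernstein. simpl. destruct j as [|j]; [simpl; ring|].
    assert (E : falling 0 (S j) = 0%R).
    { induction j as [|j IH]; [simpl; ring|].
      change (falling 0 (S j) * (0 - INR (S j)) = 0)%R. rewrite IH. ring. }
    rewrite E. ring.
  - rewrite bernstein_S. destruct j as [|j].
    + change (z * bernstein n (fun k => falling (INR k) 0) z
        + (1 - z) * bernstein n (fun k => falling (INR k) 0) z
        = falling (INR (S n)) 0 * cpow z 0).
      rewrite (IH O). simpl. ring.
    + rewrite (bernstein_ext _ (fun k => falling (INR (S k)) (S j))
        (fun k => 1 * falling (INR k) (S j) + INR (S j) * falling (INR k) j)%R).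
      * rewrite bernstein_lin, !IH, (S_INR n), falling_succ.
        rewrite RtoC_plus, RtoC_mult. simpl cpow. ring.
      * intros k. rewrite (S_INR k), falling_succ. ring.
Qed.

(* Expectation of z^J for the terminal state J of a random walk which, at time [q] in
   state [j], moves to [j + 1] with probability (n - j) / (n + q) and otherwise
   stays; [m] steps are left. *)
Fixpoint walk (n m q j : nat) (z : C) : C :=
  match m with
  | O => cpow z j
  | S i => RtoC ((INR n - INR j) / (INR n + INR q)) * walk n i (S q) (S j) z
           + RtoC ((INR j + INR q) / (INR n + INR q)) * walk n i (S q) j z
  end.

(* From k^{\underline j} (k + q) = k^{\underline{j+1}} + (j + q) k^{\underline j}. *)
Lemma bernstein_falling_rising (n m q j : nat) (z : C) : (1 <= n)%nat ->
  bernstein n (fun k => falling (INR k) j * rising (INR k + INR q) m)%R z =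
  RtoC (falling (INR n) j * rising (INR n + INR q) m) * walk n m q j z.
Proof.
  intros Hn. assert (Hn' : (0 < INR n)%R) by (apply lt_0_INR; lia).
  revert q j; induction m as [|m IH]; intros q j.
  - simpl. rewrite (bernstein_ext _ _ (fun k => falling (INR k) j)) by (intros; ring).
    rewrite bernstein_falling, Rmult_1_r. reflexivity.
  - rewrite (bernstein_ext _ _ (fun k =>
      1 * (falling (INR k) (S j) * rising (INR k + INR (S q)) m)
      + (INR j + INR q) * (falling (INR k) j * rising (INR k + INR (S q)) m))%R).
    + rewrite bernstein_lin, !IH. cbn [falling rising walk].
      rewrite S_INR, <- Rplus_assoc.
      assert (Hq := pos_INR q).
      rewrite !RtoC_mult, !RtoC_div, !RtoC_plus, !RtoC_minus by lra. field.
      rewrite <- RtoC_plus. intros E. apply RtoC_inj in E. lra.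
    + intros k. rewrite S_INR. cbn [falling rising]. rewrite <- Rplus_assoc. ring.
Qed.

Lemma bernstein_rising (n p : nat) (z : C) : (1 <= n)%nat ->
  bernstein n (fun k => rising (INR k) p) z = RtoC (rising (INR n) p) * walk n p 0 0 z.
Proof.
  intros Hn. assert (H := bernstein_falling_rising n p 0 0 z Hn).
  cbn [falling INR] in H. rewrite Rplus_0_r, Rmult_1_l in H. rewrite <- H.
  apply bernstein_ext. intros k. rewrite Rplus_0_r. ring.
Qed.

(** * Asymptotics of the walk in 1/n *)

(** The alternative [w = 0] serves the state [j = n]: a move there has probability zero, and no
    bound is available for the state [n + 1]. *)
Lemma Cmod_convex (w s B D : R) (x y t : C) :
  (0 <= w)%R -> (0 <= s)%R -> (w + s = 1)%R ->
  (w = 0 \/ Cmod x <= B)%R -> (Cmod y <= B)%R -> (Cmod t <= D)%R ->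
  (Cmod (w * x + s * y + t)%C <= B + D)%R.
Proof.
  intros Hw Hs H1 Hx Hy Ht.
  eapply Rle_trans; [apply Cmod_triangle|]. apply Rplus_le_compat; [|exact Ht].
  eapply Rle_trans; [apply Cmod_triangle|].
  rewrite !Cmod_mult, !Cmod_R, !Rabs_pos_eq by assumption.
  assert (w * Cmod x <= w * B)%R.
  { destruct Hx as [->|Hx]; [lra|]. now apply Rmult_le_compat_l. }
  assert (s * Cmod y <= s * B)%R by now apply Rmult_le_compat_l.
  replace B with (w * B + s * B)%R at 1 by (rewrite <- Rmult_plus_distr_r, H1; ring).
  lra.
Qed.

Lemma walk_weights (n q j : nat) : (1 <= n)%nat -> (j <= n)%nat -> (j <= q)%nat ->
  let w := ((INR n - INR j) / (INR n + INR q))%R in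
  let s := ((INR j + INR q) / (INR n + INR q))%R in
  (0 <= w)%R /\ (0 <= s)%R /\ (w + s = 1)%R /\ (s <= 2 * INR q / INR n)%R.
Proof.
  intros Hn Hj Hq w s.
  assert (0 < INR n)%R by (apply lt_0_INR; lia).
  assert (0 <= INR j)%R by apply pos_INR.
  assert (INR j <= INR q)%R by now apply le_INR.
  assert (INR j <= INR n)%R by now apply le_INR.
  unfold w, s. repeat split.
  - apply Rdiv_le_0_compat; lra.
  - apply Rdiv_le_0_compat; lra.
  - field. lra.
  - apply Rmult_le_compat; try lra.
    + apply Rlt_le, Rinv_0_lt_compat. lra.
    + apply Rinv_le_contravar; lra.
Qed.

Lemma Cmod_minus_le (x y : C) (B : R) :
  (Cmod x <= B)%R -> (Cmod y <= B)%R -> (Cmod (x - y)%C <= 2 * B)%R.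
Proof.
  intros Hx Hy. eapply Rle_trans; [apply Cmod_triangle|].
  rewrite Cmod_opp. lra.
Qed.

(** Induction on [m], conditioning on the first step. A move keeps the target power [j + m]; a stay
    lowers it by one, which costs at most [2 * r ^ (j + m)] and has probability at most
    [2 q / n]. *)
Lemma walk_first_order (n m q j : nat) (z : C) (r : R) :
  (1 <= r)%R -> (Cmod z <= r)%R -> (1 <= n)%nat -> (j <= n)%nat -> (j <= q)%nat ->
  (Cmod (walk n m q j z - cpow z (j + m))%C
   <= 4 * INR m * INR (q + m) / INR n * r ^ (j + m))%R.
Proof.
  intros Hr Hz Hn. revert q j.
  assert (Hn' : (0 < / INR n)%R) by (apply Rinv_0_lt_compat, lt_0_INR; lia).
  induction m as [|m IH]; intros q j Hj Hq.
  - simpl. rewrite Nat.add_0_r.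
    replace (cpow z j - cpow z j)%C with (RtoC 0) by ring.
    rewrite Cmod_0. right. unfold Rdiv. ring.
  - destruct (walk_weights n q j Hn Hj Hq) as (Hw & Hs & Hws & Hs').
    cbn [walk].
    set (w := ((INR n - INR j) / (INR n + INR q))%R) in *.
    set (s := ((INR j + INR q) / (INR n + INR q))%R) in *.
    assert (Hpow : (r ^ (j + m) <= r ^ (j + S m))%R) by (apply Rle_pow; [lra|lia]).
    assert (Hpos : (0 < r ^ (j + m))%R) by (apply pow_lt; lra).
    set (P := (r ^ (j + S m))%R) in *.
    assert (HmN : (0 <= 4 * INR m * INR (q + S m) / INR n)%R).
    { unfold Rdiv. assert (H1 := pos_INR m). assert (H2 := pos_INR (q + S m)).
      repeat apply Rmult_le_pos; lra. }
    (* By [w = 1 - s], the error splits into the average of the two inductive errors and the cost of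
       a stay. *)
    replace (w * walk n m (S q) (S j) z + s * walk n m (S q) j z - cpow z (j + S m))
      with (w * (walk n m (S q) (S j) z - cpow z (j + S m))
            + s * (walk n m (S q) j z - cpow z (j + m))
            + s * (cpow z (j + m) - cpow z (j + S m))).
    2:{ replace (RtoC w) with (1 - s) by (rewrite <- RtoC_minus; f_equal; lra). ring. }
    eapply Rle_trans.
    { apply Cmod_convex with (B := (4 * INR m * INR (q + S m) / INR n * P)%R)
        (D := (2 * INR q / INR n * (2 * P))%R); try assumption.
      - destruct (Nat.eq_dec j n) as [->|Hjn].
        + left. unfold w. unfold Rdiv. ring.
        + right. replace (j + S m)%nat with (S j + m)%nat by lia.
          eapply Rle_trans; [apply IH; lia|].
          right. unfold P. replace (S q + m)%nat with (q + S m)%nat by lia.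
          now replace (j + S m)%nat with (S j + m)%nat by lia.
      - eapply Rle_trans; [apply IH; lia|].
        replace (S q + m)%nat with (q + S m)%nat by lia.
        now apply Rmult_le_compat_l.
      - rewrite Cmod_mult, Cmod_R, Rabs_pos_eq by assumption.
        apply Rmult_le_compat; try assumption; try apply Cmod_ge_0.
        apply Cmod_minus_le; apply Cmod_cpow_le; auto; lia. }
    assert (HP : (0 < P * / INR n)%R) by (apply Rmult_lt_0_compat; lra).
    rewrite plus_INR, !S_INR. unfold Rdiv.
    assert (H1 := pos_INR m). assert (H2 := pos_INR q).
    apply Rminus_le_0.
    replace (_ - _)%R with ((4 * (INR m + 1)) * (P * / INR n))%R by ring.
    apply Rmult_le_pos; lra.
Qed.

(** The coefficient is the sum of [2 i / n] for [i] from [q] to [q + m - 1], the expected number of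
    stays to leading order. Starting on the diagonal [j = q], a move stays on the diagonal, so
    induction applies; a stay has probability of order [q / n], so [walk_first_order] suffices after
    it. *)
Lemma walk_second_order (n m q : nat) (z : C) (r : R) :
  (1 <= r)%R -> (Cmod z <= r)%R -> (1 <= n)%nat -> (q <= n)%nat ->
  (Cmod (walk n m q q z - cpow z (q + m)
    - RtoC ((2 * INR q * INR m + INR m * (INR m - 1)) / INR n)
      * (cpow z (q + m - 1) - cpow z (q + m)))%C
   <= 16 * INR (q + m) ^ 3 * INR m / INR n ^ 2 * r ^ (q + m))%R.
Proof.
  intros Hr Hz Hn. revert q.
  assert (HnR : (0 < INR n)%R) by (apply lt_0_INR; lia).
  assert (Hn' : (0 < / INR n)%R) by now apply Rinv_0_lt_compat.
  induction m as [|m IH]; intros q Hq.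
  - simpl. rewrite Nat.add_0_r.
    replace (2 * INR q * 0 + 0 * (0 - 1))%R with 0%R by ring.
    unfold Rdiv. rewrite Rmult_0_l.
    replace (_ - _ - _)%C with (RtoC 0) by ring.
    rewrite Cmod_0. right. ring.
  - destruct (walk_weights n q q Hn Hq (Nat.le_refl q)) as (Hw & Hs & Hws & Hs').
    cbn [walk].
    set (w := ((INR n - INR q) / (INR n + INR q))%R) in *.
    (* The exact probability of staying is [2 q / (n + q)]; this is the cost of replacing its
       denominator by [n]. *)
    assert (Hs2 : (Rabs ((INR q + INR q) / (INR n + INR q) - 2 * INR q / INR n)
                   <= 2 * INR q ^ 2 / INR n ^ 2)%R).
    { assert (H2 := pos_INR q).
      replace (_ - _)%R with (- (2 * INR q ^ 2 * (/ INR n * / (INR n + INR q))))%R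
        by (field; lra).
      rewrite Rabs_Ropp, Rabs_pos_eq.
      - unfold Rdiv. apply Rmult_le_compat_l.
        + apply Rmult_le_pos; [lra|apply pow2_ge_0].
        + replace (/ INR n ^ 2)%R with (/ INR n * / INR n)%R by (field; lra).
          apply Rmult_le_compat_l; [lra|]. apply Rinv_le_contravar; lra.
      - apply Rmult_le_pos.
        + apply Rmult_le_pos; [lra|apply pow2_ge_0].
        + apply Rmult_le_pos; [lra|]. apply Rlt_le, Rinv_0_lt_compat. lra. }
    set (s := ((INR q + INR q) / (INR n + INR q))%R) in *.
    assert (Hpow : (r ^ (q + m) <= r ^ (q + S m))%R) by (apply Rle_pow; [lra|lia]).
    assert (Hpos : (0 < r ^ (q + m))%R) by (apply pow_lt; lra).
    assert (Hfirst := walk_first_order n m (S q) q z r Hr Hz Hn Hq (Nat.le_succ_diag_r q)).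
    assert (HW : w = 0%R \/ (q < n)%nat).
    { destruct (Nat.eq_dec q n) as [->|Hqn]; [left|right; lia].
      unfold w, Rdiv. ring. }
    specialize (IH (S q)).
    replace (S q + m - 1)%nat with (q + m)%nat in IH by lia.
    replace (S q + m)%nat with (q + S m)%nat in IH, Hfirst by lia.
    replace (q + S m - 1)%nat with (q + m)%nat by lia.
    set (Z0 := cpow z (q + m)) in *. set (Z1 := cpow z (q + S m)) in *.
    set (P := (r ^ (q + S m))%R) in *.
    set (W0 := walk n m (S q) q z) in *. set (W1 := walk n m (S q) (S q) z) in *.
    (* [beta / n] is the coefficient for the walk after a move; adding [2 q] to [beta] gives the
       numerator for [S m] steps. *)
    set (beta := (2 * INR (S q) * INR m + INR m * (INR m - 1))%R) in *.
    assert (HZ : (Cmod (Z0 - Z1)%C <= 2 * P)%R).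
    { apply Cmod_minus_le; apply Cmod_cpow_le; auto; lia. }
    assert (Hm := pos_INR m). assert (Hq' := pos_INR q).
    set (N := INR (q + S m)) in *.
    assert (HN : N = (INR q + INR m + 1)%R).
    { unfold N. rewrite plus_INR, S_INR. ring. }
    assert (Hbeta : (0 <= beta <= N ^ 2)%R).
    { assert (H1 := Rmult_le_pos _ _ Hq' Hm). assert (H2 := Rmult_le_pos _ _ Hm Hm).
      assert (H3 := pow2_ge_0 (INR q)).
      unfold beta. rewrite HN, S_INR. simpl in *. split; lra. }
    (* Four errors: the inductive one after a move, the first-order one after a stay, the
       replacement of [s] by [2 q / n], and the loss from weighting [beta / n] by [w = 1 - s]
       instead of 1. They are bounded in [T1] to [T4]. *)
    replace (w * W1 + s * W0 - Z1
       - RtoC ((2 * INR q * INR (S m) + INR (S m) * (INR (S m) - 1)) / INR n) * (Z0 - Z1))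
      with (w * (W1 - Z1 - RtoC (beta / INR n) * (Z0 - Z1)) + s * (W0 - Z0)
        + RtoC (s - 2 * INR q / INR n) * (Z0 - Z1)
        + RtoC (- (s * (beta / INR n))) * (Z0 - Z1)).
    2:{ replace ((2 * INR q * INR (S m) + INR (S m) * (INR (S m) - 1)) / INR n)%R
          with (2 * INR q / INR n + beta / INR n)%R
          by (unfold beta; rewrite !S_INR; field; lra).
        replace (RtoC w) with (1 - s) by (rewrite <- RtoC_minus; f_equal; lra).
        rewrite RtoC_minus, RtoC_opp, RtoC_mult, RtoC_plus. ring. }
    set (u := (/ INR n)%R) in *.
    assert (T1 : (Cmod (w * (W1 - Z1 - RtoC (beta / INR n) * (Z0 - Z1)))
                  <= 16 * N ^ 3 * INR m * (u ^ 2 * P))%R).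
    { assert (0 <= 16 * N ^ 3 * INR m * (u ^ 2 * P))%R.
      { repeat apply Rmult_le_pos; try lra; try (rewrite HN; lra); apply pow_le; lra. }
      destruct HW as [->|Hqn].
      - rewrite Cmult_0_l, Cmod_0. assumption.
      - rewrite Cmod_mult, Cmod_R, Rabs_pos_eq by assumption.
        specialize (IH Hqn).
        replace (16 * N ^ 3 * INR m / INR n ^ 2 * P)%R
          with (16 * N ^ 3 * INR m * (u ^ 2 * P))%R in IH
          by (unfold u; field; lra).
        rewrite <- (Rmult_1_l (16 * N ^ 3 * INR m * (u ^ 2 * P))).
        apply Rmult_le_compat; try assumption; [apply Cmod_ge_0|lra]. }
    assert (T2 : (Cmod (s * (W0 - Z0)) <= 8 * N ^ 3 * (u ^ 2 * P))%R).
    { rewrite Cmod_mult, Cmod_R, Rabs_pos_eq by assumption.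
      apply Rle_trans with ((2 * N * u) * (4 * N * N * u * P))%R; [|right; ring].
      apply Rmult_le_compat; try assumption; try apply Cmod_ge_0.
      - eapply Rle_trans; [apply Hs'|]. unfold Rdiv. apply Rmult_le_compat_r; lra.
      - eapply Rle_trans; [apply Hfirst|]. unfold Rdiv.
        apply Rmult_le_compat; try lra.
        + fold u. repeat apply Rmult_le_pos; lra.
        + apply Rmult_le_compat_r; [fold u; lra|].
          apply Rmult_le_compat_r; lra. }
    assert (T3 : (Cmod (RtoC (s - 2 * INR q / INR n) * (Z0 - Z1)) <= 4 * N ^ 3 * (u ^ 2 * P))%R).
    { rewrite Cmod_mult, Cmod_R.
      apply Rle_trans with ((2 * N ^ 3 * u ^ 2) * (2 * P))%R; [|right; ring].
      apply Rmult_le_compat; try assumption; try apply Cmod_ge_0; try apply Rabs_pos.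
      eapply Rle_trans; [apply Hs2|]. unfold Rdiv. rewrite <- pow_inv.
      apply Rmult_le_compat_r; [apply pow2_ge_0|].
      apply Rmult_le_compat_l; [lra|]. apply Rle_trans with (N ^ 2)%R.
      - apply pow_incr. lra.
      - apply Rle_pow; [lra|lia]. }
    assert (T4 : (Cmod (RtoC (- (s * (beta / INR n))) * (Z0 - Z1)) <= 4 * N ^ 3 * (u ^ 2 * P))%R).
    { rewrite Cmod_mult, Cmod_R, Rabs_Ropp, Rabs_mult.
      assert (0 <= beta / INR n)%R by (apply Rmult_le_pos; fold u; lra).
      rewrite !Rabs_pos_eq by assumption.
      apply Rle_trans with ((2 * N * u * (N ^ 2 * u)) * (2 * P))%R; [|right; ring].
      apply Rmult_le_compat; try assumption; try apply Cmod_ge_0.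
      - now apply Rmult_le_pos.
      - apply Rmult_le_compat; try assumption.
        + eapply Rle_trans; [apply Hs'|]. unfold Rdiv. apply Rmult_le_compat_r; lra.
        + unfold Rdiv. apply Rmult_le_compat_r; [fold u; lra|apply Hbeta]. }
    (* The last three bounds have constants 8, 4 and 4, which make up the increment 16 from [m] to
       [S m]. *)
    replace (16 * N ^ 3 * INR (S m) / INR n ^ 2 * P)%R
      with (16 * N ^ 3 * INR m * (u ^ 2 * P) + 8 * N ^ 3 * (u ^ 2 * P)
            + 4 * N ^ 3 * (u ^ 2 * P) + 4 * N ^ 3 * (u ^ 2 * P))%R
      by (rewrite S_INR; unfold u; field; lra).
    repeat (eapply Rle_trans; [apply Cmod_triangle|]; apply Rplus_le_compat; [|assumption]).
    assumption.
Qed.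

(** * The error for a pair of monomials *)

(** This is the error of the theorem for [z^j] and [z^k], with each value of [U n] already replaced
    by its walk. *)
Definition monomial_error (n j k : nat) (z : C) : C :=
  walk n (j + k) 0 0 z - walk n j 0 0 z * walk n k 0 0 z
  - 2 * z * (1 - z) * (INR j * cpow z (j - 1)) * (INR k * cpow z (k - 1)) / INR n.

Lemma walk_first_order_0 (n p : nat) (z : C) (r : R) :
  (1 <= r)%R -> (Cmod z <= r)%R -> (1 <= n)%nat ->
  (Cmod (walk n p 0 0 z - cpow z p) <= 4 * (INR p + 1) ^ 2 * r ^ p / INR n)%R.
Proof.
  intros Hr Hz Hn.
  assert (H := walk_first_order n p 0 0 z r Hr Hz Hn (Nat.le_0_l n) (Nat.le_refl 0)).
  simpl Nat.add in H. eapply Rle_trans; [exact H|].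
  assert (0 < / INR n)%R by (apply Rinv_0_lt_compat, lt_0_INR; lia).
  assert (0 < r ^ p)%R by (apply pow_lt; lra).
  assert (Hp := pos_INR p). unfold Rdiv. rewrite Rmult_assoc, (Rmult_comm (/ _)).
  rewrite <- Rmult_assoc.
  do 2 (apply Rmult_le_compat_r; [lra|]). simpl. nra.
Qed.

Lemma walk_second_order_0 (n p : nat) (z : C) (r : R) :
  (1 <= r)%R -> (Cmod z <= r)%R -> (1 <= n)%nat ->
  (Cmod (walk n p 0 0 z - cpow z p
    - RtoC (INR p * (INR p - 1) / INR n) * (cpow z (p - 1) - cpow z p))
   <= 16 * INR p ^ 4 * r ^ p / INR n ^ 2)%R.
Proof.
  intros Hr Hz Hn.
  assert (H := walk_second_order n p 0 z r Hr Hz Hn (Nat.le_0_l n)).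
  simpl Nat.add in H. change (INR 0) with 0%R in H.
  rewrite Rmult_0_r, Rmult_0_l, Rplus_0_l in H.
  eapply Rle_trans; [exact H|]. right. field.
  apply not_0_INR; lia.
Qed.

(** The terms of order 1/n cancel exactly. What remains is three second-order remainders and a
    product of two first-order errors, all of order [1 / n ^ 2]. *)
Lemma Cmod_monomial_error (n j k : nat) (z : C) (r : R) :
  (1 <= r)%R -> (Cmod z <= r)%R -> (1 <= n)%nat ->
  (Cmod (monomial_error n j k z)
   <= 64 * ((INR j + 1) ^ 4 * r ^ j) * ((INR k + 1) ^ 4 * r ^ k) / INR n ^ 2)%R.
Proof.
  intros Hr Hz Hn.
  assert (HnR : (0 < INR n)%R) by (apply lt_0_INR; lia).
  assert (HnC : RtoC (INR n) <> 0) by (intros E; apply RtoC_inj in E; lra).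
  assert (Hu : (0 < / INR n ^ 2)%R) by (apply Rinv_0_lt_compat, pow_lt, HnR).
  assert (Hpos : forall i, (0 <= (INR i + 1) ^ 4 * r ^ i)%R).
  { intros i. assert (Hi := pos_INR i). apply Rmult_le_pos; apply pow_le; lra. }
  assert (HB : (0 <= 64 * ((INR j + 1) ^ 4 * r ^ j) * ((INR k + 1) ^ 4 * r ^ k)
                 / INR n ^ 2)%R).
  { apply Rmult_le_pos; [|lra].
    apply Rmult_le_pos; [apply Rmult_le_pos; [lra|]|]; apply Hpos. }
  (* If an index is 0 the error vanishes identically. For positive indices the exponents [j - 1] and
     [k - 1] are not truncated, which the identity below relies on. *)
  destruct j as [|j'].
  { unfold monomial_error. simpl Nat.add. change (walk n 0 0 0 z) with (RtoC 1).
    change (INR 0) with 0%R.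
    replace (_ - _ - _) with (RtoC 0) by (unfold Cdiv; ring).
    rewrite Cmod_0. exact HB. }
  destruct k as [|k'].
  { unfold monomial_error. rewrite Nat.add_0_r. change (walk n 0 0 0 z) with (RtoC 1).
    change (INR 0) with 0%R.
    replace (_ - _ - _) with (RtoC 0) by (unfold Cdiv; ring).
    rewrite Cmod_0. exact HB. }
  set (j := S j') in *. set (k := S k') in *. clear HB.
  assert (Fj := walk_first_order_0 n j z r Hr Hz Hn).
  assert (Fk := walk_first_order_0 n k z r Hr Hz Hn).
  assert (Sj := walk_second_order_0 n j z r Hr Hz Hn).
  assert (Sk := walk_second_order_0 n k z r Hr Hz Hn).
  assert (Sjk := walk_second_order_0 n (j + k) z r Hr Hz Hn).
  set (A := fun p => walk n p 0 0 z - cpow z p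
    - RtoC (INR p * (INR p - 1) / INR n) * (cpow z (p - 1) - cpow z p)).
  fold (A j) in Sj. fold (A k) in Sk. fold (A (j + k)%nat) in Sjk.
  replace (monomial_error n j k z)
    with (A (j + k)%nat + - (cpow z k * A j) + - (cpow z j * A k)
          + - ((walk n j 0 0 z - cpow z j) * (walk n k 0 0 z - cpow z k))).
  2:{ unfold monomial_error, A, j, k.
      replace (S j' + S k' - 1)%nat with (j' + S k')%nat by lia.
      replace (S j' - 1)%nat with j' by lia. replace (S k' - 1)%nat with k' by lia.
      rewrite !cpow_add, !RtoC_div, !RtoC_mult, !RtoC_minus, !plus_INR, !RtoC_plus by lra.
      simpl cpow. field. exact HnC. }
  set (J := (INR j + 1)%R) in *. set (K := (INR k + 1)%R) in *.
  assert (HJ : (1 <= J)%R) by (unfold J; assert (H := pos_INR j); lra).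
  assert (HK : (1 <= K)%R) by (unfold K; assert (H := pos_INR k); lra).
  assert (Pj : (0 < r ^ j)%R) by (apply pow_lt; lra).
  assert (Pk : (0 < r ^ k)%R) by (apply pow_lt; lra).
  assert (J4 : (1 <= J ^ 4)%R) by (apply pow_R1_Rle; lra).
  assert (K4 : (1 <= K ^ 4)%R) by (apply pow_R1_Rle; lra).
  (* Common form of the four bounds, with [X] equal to [(j + k)^4], [j^4], [k^4] and [J^2 K^2]; four
     times 16 gives 64. *)
  assert (Hle : forall X Y : R, (X <= J ^ 4 * K ^ 4)%R ->
    (Y = 16 * X * (r ^ j * r ^ k) / INR n ^ 2)%R ->
    (Y <= 16 * (J ^ 4 * r ^ j) * (K ^ 4 * r ^ k) / INR n ^ 2)%R).
  { intros X Y HX ->. unfold Rdiv. apply Rmult_le_compat_r; [lra|].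
    replace (16 * (J ^ 4 * r ^ j) * (K ^ 4 * r ^ k))%R
      with (16 * (J ^ 4 * K ^ 4) * (r ^ j * r ^ k))%R by ring.
    apply Rmult_le_compat_r; [apply Rmult_le_pos; lra|lra]. }
  replace (64 * (J ^ 4 * r ^ j) * (K ^ 4 * r ^ k) / INR n ^ 2)%R
    with (16 * (J ^ 4 * r ^ j) * (K ^ 4 * r ^ k) / INR n ^ 2
          + 16 * (J ^ 4 * r ^ j) * (K ^ 4 * r ^ k) / INR n ^ 2
          + 16 * (J ^ 4 * r ^ j) * (K ^ 4 * r ^ k) / INR n ^ 2
          + 16 * (J ^ 4 * r ^ j) * (K ^ 4 * r ^ k) / INR n ^ 2)%R by (field; lra).
  assert (Hj := pos_INR j). assert (Hk := pos_INR k).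
  eapply Rle_trans; [apply Cmod_triangle|]; apply Rplus_le_compat.
  1: eapply Rle_trans; [apply Cmod_triangle|]; apply Rplus_le_compat.
  1: eapply Rle_trans; [apply Cmod_triangle|]; apply Rplus_le_compat.
  - eapply Rle_trans; [exact Sjk|].
    apply Hle with (INR (j + k) ^ 4)%R.
    + rewrite <- Rpow_mult_distr. apply pow_incr. rewrite plus_INR. unfold J, K. nra.
    + rewrite pow_add. field. lra.
  - rewrite Cmod_opp, Cmod_mult.
    eapply Rle_trans.
    { apply Rmult_le_compat; [apply Cmod_ge_0|apply Cmod_ge_0| |exact Sj].
      now apply (Cmod_cpow_le z r k k). }
    apply Hle with (INR j ^ 4)%R; [|field; lra].
    rewrite <- (Rmult_1_r (INR j ^ 4)). apply Rmult_le_compat; try lra.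
    + apply pow_le; lra.
    + apply pow_incr; unfold J; lra.
  - rewrite Cmod_opp, Cmod_mult.
    eapply Rle_trans.
    { apply Rmult_le_compat; [apply Cmod_ge_0|apply Cmod_ge_0| |exact Sk].
      now apply (Cmod_cpow_le z r j j). }
    apply Hle with (INR k ^ 4)%R; [|field; lra].
    rewrite <- (Rmult_1_l (INR k ^ 4)). apply Rmult_le_compat; try lra.
    + apply pow_le; lra.
    + apply pow_incr; unfold K; lra.
  - rewrite Cmod_opp, Cmod_mult.
    eapply Rle_trans.
    { apply Rmult_le_compat; [apply Cmod_ge_0|apply Cmod_ge_0|exact Fj|exact Fk]. }
    apply Hle with (J ^ 2 * K ^ 2)%R; [|field; lra].
    apply Rmult_le_compat; try (apply pow_le; lra); apply Rle_pow; lra || lia.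
Qed.

(** * Beta integrals and integration of complex functions *)

Lemma is_RInt_RtoC (phi : R -> R) (a b l : R) :
  is_RInt phi a b l ->
  is_RInt (V := C_R_NormedModule) (fun t => RtoC (phi t)) a b (RtoC l).
Proof.
  intros H. apply (is_RInt_fct_extend_pair (U := R_NormedModule) (V := R_NormedModule)).
  - exact H.
  - simpl. replace 0%R with (scal (b - a) 0)%R at 1.
    + apply (is_RInt_const (V := R_NormedModule) a b 0).
    + apply Rmult_0_r.
Qed.

Lemma is_RInt_beta (a b : nat) :
  is_RInt (fun t => (t ^ a * (1 - t) ^ b)%R) 0 1
    (INR (fact a) * INR (fact b) / INR (fact (a + b + 1)))%R.
Proof.
  revert a; induction b as [|b IH]; intros a.
  - assert (Ha : (INR a + 1 <> 0)%R) by (assert (H := pos_INR a); lra).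
    apply is_RInt_ext with (fun t => (t ^ a)%R).
    { intros t _. simpl. ring. }
    replace (INR (fact a) * INR (fact 0) / INR (fact (a + 0 + 1)))%R
      with (minus (1 ^ (a + 1) / (INR a + 1)) (0 ^ (a + 1) / (INR a + 1)))%R.
    + apply (is_RInt_derive (fun t => t ^ (a + 1) / (INR a + 1))%R).
      * intros t _. auto_derive; [trivial|].
        rewrite Nat.add_1_r. simpl pred. rewrite S_INR. field. exact Ha.
      * intros t _. apply (ex_derive_continuous (fun t => t ^ a)%R). auto_derive. trivial.
    + unfold minus, plus, opp; simpl. rewrite Nat.add_0_r, Nat.add_1_r, pow1.
      rewrite pow_i by lia.
      change (fact (S a)) with (S a * fact a)%nat. change (fact 0) with 1%nat.
      rewrite mult_INR, S_INR. simpl INR.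
      field. split; [apply INR_fact_neq_0|exact Ha].
  - assert (Ha : (INR a + 1 <> 0)%R) by (assert (H := pos_INR a); lra).
    (* Integration by parts: integrating the derivative of [t ^ S a * (1 - t) ^ S b], which vanishes
       at both ends, trades a power of [1 - t] for one of [t]. *)
    assert (D : is_RInt (fun t => (INR a + 1) * (t ^ a * (1 - t) ^ S b)
                - (INR b + 1) * (t ^ S a * (1 - t) ^ b))%R 0 1
                (minus (1 ^ (S a) * (1 - 1) ^ (S b)) (0 ^ (S a) * (1 - 0) ^ (S b)))%R).
    { apply (is_RInt_derive (fun t => t ^ S a * (1 - t) ^ S b)%R).
      - intros t _. auto_derive; [trivial|].
        change (match a with O => 1%R | S _ => (INR a + 1)%R end) with (INR (S a)).
        change (match b with O => 1%R | S _ => (INR b + 1)%R end) with (INR (S b)).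
        rewrite !S_INR. unfold Rminus. simpl. ring.
      - intros t _. apply (ex_derive_continuous (fun t => (INR a + 1) * (t ^ a * (1 - t) ^ S b)
                - (INR b + 1) * (t ^ S a * (1 - t) ^ b))%R). auto_derive. trivial. }
    assert (E := is_RInt_plus _ _ _ _ _ _ (is_RInt_scal _ _ _ (/ (INR a + 1)) _ D)
      (is_RInt_scal _ _ _ ((INR b + 1) / (INR a + 1)) _ (IH (S a)))).
    eapply is_RInt_ext; [|replace (_ / _)%R with
      (plus (scal (/ (INR a + 1))
            (minus (1 ^ S a * (1 - 1) ^ S b) (0 ^ S a * (1 - 0) ^ S b)))
         (scal ((INR b + 1) / (INR a + 1))
            (INR (fact (S a)) * INR (fact b) / INR (fact (S a + b + 1)))))%R; [exact E|]].
    + intros t _. unfold plus, scal; simpl. unfold mult; simpl. field. exact Ha.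
    + change ((/ (INR a + 1) * (1 ^ S a * (1 - 1) ^ S b - 0 ^ S a * (1 - 0) ^ S b)
        + (INR b + 1) / (INR a + 1)
          * (INR (fact (S a)) * INR (fact b) / INR (fact (S a + b + 1))))%R
        = (INR (fact a) * INR (fact (S b)) / INR (fact (a + S b + 1)))%R).
      replace (a + S b + 1)%nat with (S (a + b + 1))%nat by lia.
      change (S a + b + 1)%nat with (S (a + b + 1))%nat.
      change (fact (S a)) with (S a * fact a)%nat. change (fact (S b)) with (S b * fact b)%nat.
      rewrite !mult_INR, !S_INR.
      replace (1 - 1)%R with 0%R by ring. rewrite !pow_i by lia.
      field. split; [apply INR_fact_neq_0|exact Ha].
Qed.

(** The scalars of [C_R_NormedModule] are real, so a complex factor is handled through real and
    imaginary parts. *)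
Lemma is_RInt_Cmult_l (c : C) (u : R -> C) (a b : R) (l : C) :
  is_RInt (V := C_R_NormedModule) u a b l ->
  is_RInt (V := C_R_NormedModule) (fun t => c * u t) a b (c * l).
Proof.
  intros H.
  assert (H1 := is_RInt_fct_extend_fst (U := R_NormedModule) (V := R_NormedModule) _ _ _ _ H).
  assert (H2 := is_RInt_fct_extend_snd (U := R_NormedModule) (V := R_NormedModule) _ _ _ _ H).
  apply (is_RInt_fct_extend_pair (U := R_NormedModule) (V := R_NormedModule)).
  - exact (is_RInt_minus _ _ _ _ _ _ (is_RInt_scal _ _ _ (fst c) _ H1)
             (is_RInt_scal _ _ _ (snd c) _ H2)).
  - exact (is_RInt_plus _ _ _ _ _ _ (is_RInt_scal _ _ _ (fst c) _ H2)
             (is_RInt_scal _ _ _ (snd c) _ H1)).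
Qed.

(** * Limits of complex sequences *)

(** Stated through a real null sequence, so that squeezing and the arithmetic of real limits apply
    directly. *)
Definition climit (x : nat -> C) (l : C) : Prop :=
  is_lim_seq (fun n => Cmod (x n - l)) 0.

Lemma climit_of_le (x : nat -> C) (l : C) (tau : nat -> R) :
  (forall n, (Cmod (x n - l) <= tau n)%R) -> is_lim_seq tau 0 -> climit x l.
Proof.
  intros H Ht. apply is_lim_seq_le_le with (fun _ => 0%R) tau.
  - intros n. split; [apply Cmod_ge_0|apply H].
  - apply is_lim_seq_const.
  - exact Ht.
Qed.

Lemma climit_ext (x y : nat -> C) (l : C) :
  (forall n, x n = y n) -> climit x l -> climit y l.
Proof.
  intros H. apply is_lim_seq_ext. intros n. now rewrite H.
Qed.

Lemma climit_const (c : C) : climit (fun _ => c) c.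
Proof.
  apply climit_of_le with (fun _ => 0%R); [|apply is_lim_seq_const].
  intros _. replace (c - c) with (RtoC 0) by ring. rewrite Cmod_0. lra.
Qed.

Lemma climit_plus (x y : nat -> C) (l m : C) :
  climit x l -> climit y m -> climit (fun n => x n + y n) (l + m).
Proof.
  intros Hx Hy.
  apply climit_of_le with (fun n => Cmod (x n - l) + Cmod (y n - m))%R.
  - intros n. replace (x n + y n - (l + m)) with ((x n - l) + (y n - m)) by ring.
    apply Cmod_triangle.
  - rewrite <- (Rplus_0_r 0). now apply is_lim_seq_plus'.
Qed.

Lemma climit_mult (x y : nat -> C) (l m : C) :
  climit x l -> climit y m -> climit (fun n => x n * y n) (l * m).
Proof.
  intros Hx Hy.
  apply climit_of_le with (fun n => Cmod (x n - l) * Cmod (y n - m)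
    + Cmod l * Cmod (y n - m) + Cmod m * Cmod (x n - l))%R.
  - intros n.
    replace (x n * y n - l * m)
      with ((x n - l) * (y n - m) + l * (y n - m) + m * (x n - l)) by ring.
    eapply Rle_trans; [apply Cmod_triangle|]. rewrite <- !Cmod_mult.
    apply Rplus_le_compat_r, Cmod_triangle.
  - replace (Finite 0) with (Finite (0 * 0 + Cmod l * 0 + Cmod m * 0)) by (f_equal; ring).
    apply is_lim_seq_plus'; [apply is_lim_seq_plus'|]; apply is_lim_seq_mult';
      try assumption; apply is_lim_seq_const.
Qed.

Lemma climit_opp (x : nat -> C) (l : C) : climit x l -> climit (fun n => - x n) (- l).
Proof.
  intros H. apply climit_ext with (fun n => - (1) * x n); [intros n; ring|].
  replace (- l) with (- (1) * l) by ring. apply climit_mult; [apply climit_const|exact H].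
Qed.

Lemma climit_Csum (x : nat -> nat -> C) (l : nat -> C) (m : nat) :
  (forall i, (i <= m)%nat -> climit (fun n => x n i) (l i)) ->
  climit (fun n => Csum (x n) m) (Csum l m).
Proof.
  induction m as [|m IH]; simpl; intros H; [now apply H|].
  apply climit_plus; auto.
Qed.

Lemma Cmod_climit_le (x : nat -> C) (l : C) (B : R) (N : nat) :
  (forall n, (N <= n)%nat -> (Cmod (x n) <= B)%R) -> climit x l -> (Cmod l <= B)%R.
Proof.
  intros H Hx.
  apply (is_lim_seq_le_loc (fun _ => Cmod l) (fun n => B + Cmod (x n - l))%R (Cmod l) B).
  - exists N. intros n Hn. specialize (H n Hn).
    replace l with (x n + - (x n - l)) at 1 by ring.
    eapply Rle_trans; [apply Cmod_triangle|]. rewrite Cmod_opp. lra.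
  - apply is_lim_seq_const.
  - rewrite <- (Rplus_0_r B) at 1. apply is_lim_seq_plus'; [apply is_lim_seq_const|exact Hx].
Qed.

Lemma RInt_climit (u : nat -> R -> C) (v : R -> C) (tau : nat -> R) :
  (forall n, ex_RInt (V := C_R_NormedModule) (u n) 0 1) -> is_lim_seq tau 0 ->
  (forall n t, (0 <= t <= 1)%R -> (Cmod (u n t - v t) <= tau n)%R) ->
  ex_RInt (V := C_R_NormedModule) v 0 1 /\ climit (fun n => cint01 (u n)) (cint01 v).
Proof.
  intros Hu Htau Huv.
  (* [filterlim_RInt] wants uniform convergence on the whole line; composing with the retraction
     onto [0,1] provides it and leaves the integrals unchanged. *)
  set (clamp := fun t => Rmax 0 (Rmin 1 t)).
  assert (Hc : forall t, (0 <= clamp t <= 1)%R).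
  { intros t. unfold clamp. split; [apply Rmax_l|].
    apply Rmax_lub; [lra|apply Rmin_l]. }
  assert (Hci : forall t, (0 < t < 1)%R -> clamp t = t).
  { intros t Ht. unfold clamp. rewrite Rmin_right, Rmax_right; lra. }
  assert (Hi : forall w : R -> C, forall l,
    is_RInt (V := C_R_NormedModule) w 0 1 l <->
    is_RInt (V := C_R_NormedModule) (fun t => w (clamp t)) 0 1 l).
  { intros w l. split; apply is_RInt_ext; intros t;
      rewrite Rmin_left, Rmax_right by lra; intros Ht; now rewrite Hci. }
  assert (Hex : ex_RInt (V := C_R_NormedModule) v 0 1).
  { destruct (filterlim_RInt (V := C_R_CompleteNormedModule)
      (fun n t => u n (clamp t)) 0 1 eventually _ (fun t => v (clamp t))
      (fun n => cint01 (u n))) as (l & _ & Hl).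
    - intros n. apply (Hi (u n)), (RInt_correct (V := C_R_CompleteNormedModule)), Hu.
    - apply filterlim_locally. intros eps.
      apply is_lim_seq_spec in Htau. destruct (Htau eps) as [N HN].
      exists N. intros n Hn t.
      apply (C_NormedModule_mixin_compat1 (v (clamp t)) (u n (clamp t))).
      eapply Rle_lt_trans; [apply (Huv n), Hc|].
      specialize (HN n Hn). rewrite Rminus_0_r in HN.
      eapply Rle_lt_trans; [apply Rle_abs|exact HN].
    - exists l. now apply Hi. }
  split; [exact Hex|].
  apply climit_of_le with tau; [|exact Htau]. intros n.
  assert (D := is_RInt_minus _ _ _ _ _ _
    (RInt_correct (V := C_R_CompleteNormedModule) _ _ _ (Hu n))
    (RInt_correct (V := C_R_CompleteNormedModule) _ _ _ Hex)).
  assert (Hnorm : forall c : C, norm (V := C_R_NormedModule) c = Cmod c).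
  { intros c. symmetry. apply (Cmod_norm c). }
  assert (L := norm_RInt_le _ (fun _ => tau n) 0 1 _ _ Rle_0_1
    (fun t Ht => Rle_trans _ _ _ (Req_le _ _ (Hnorm _)) (Huv n t Ht)) D
    (is_RInt_const 0 1 (tau n))).
  rewrite Hnorm in L. eapply Rle_trans; [exact L|].
  right. change ((1 - 0) * tau n = tau n)%R. ring.
Qed.

(** * Linearity and continuity of the operator *)

(** [RInt] is total, so linearity of [U n] needs the integrals to exist. These are exactly the
    integrands of [U n], with [i = k - 1]; there are none when [n = 1]. *)
Definition integrable (n : nat) (h : C -> C) : Prop :=
  forall i, (S (S i) <= n)%nat ->
    ex_RInt (V := C_R_NormedModule) (fun t => h (RtoC t) * pnk (n - 2) i (RtoC t)) 0 1.

Lemma U_1 (h : C -> C) (z : C) : U 1 h z = (1 - z) * h 0 + z * h 1.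
Proof.
  unfold U. rewrite sum_n_m_zero by lia.
  replace (INR 1 - 1)%R with 0%R by (simpl; ring). simpl cpow. ring.
Qed.

(** Writing [n = l + 2] and [k = i + 1] removes the truncated subtractions. *)
Lemma U_SS (l : nat) (h : C -> C) (z : C) :
  U (S (S l)) h z =
  RtoC (INR (S l)) * Csum (fun i => cint01 (fun t => h (RtoC t) * pnk l i (RtoC t))
                                    * pnk (S (S l)) (S i) z) l
  + cpow (1 - z) (S (S l)) * h 0 + cpow z (S (S l)) * h 1.
Proof.
  unfold U.
  replace (S (S l) - 1)%nat with (S l) by lia.
  replace (S (S l) - 2)%nat with l by lia.
  rewrite <- sum_n_m_S.
  change (@sum_n_m C_AbelianGroup ?x 0 l) with (sum_n (G := C_AbelianGroup) x l).
  rewrite Csum_sum_n. rewrite (S_INR (S l)).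
  replace (INR (S l) + 1 - 1)%R with (INR (S l)) by ring.
  do 2 f_equal. f_equal. apply Csum_ext. intros i _.
  now replace (S i - 1)%nat with i by lia.
Qed.

Lemma integrable_U_plus (n : nat) (u v : C -> C) (z : C) : (1 <= n)%nat ->
  integrable n u -> integrable n v ->
  integrable n (fun w => u w + v w) /\
  U n (fun w => u w + v w) z = U n u z + U n v z.
Proof.
  intros Hn Hu Hv.
  assert (H : forall i, (S (S i) <= n)%nat ->
    is_RInt (V := C_R_NormedModule)
      (fun t => (u (RtoC t) + v (RtoC t)) * pnk (n - 2) i (RtoC t)) 0 1
      (cint01 (fun t => u (RtoC t) * pnk (n - 2) i (RtoC t))
       + cint01 (fun t => v (RtoC t) * pnk (n - 2) i (RtoC t)))).
  { intros i Hi.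
    eapply is_RInt_ext; [|exact (is_RInt_plus _ _ _ _ _ _
      (RInt_correct (V := C_R_CompleteNormedModule) _ _ _ (Hu i Hi))
      (RInt_correct (V := C_R_CompleteNormedModule) _ _ _ (Hv i Hi)))].
    intros t _. symmetry. apply Cmult_plus_distr_r. }
  split; [intros i Hi; eexists; apply H, Hi|].
  destruct n as [|[|l]]; [lia|rewrite !U_1; ring|].
  rewrite !U_SS.
  rewrite (Csum_ext _ (fun i =>
    cint01 (fun t => u (RtoC t) * pnk l i (RtoC t)) * pnk (S (S l)) (S i) z
    + cint01 (fun t => v (RtoC t) * pnk l i (RtoC t)) * pnk (S (S l)) (S i) z)).
  - rewrite Csum_plus. ring.
  - intros i Hi. specialize (H i). replace (S (S l) - 2)%nat with l in H by lia.
    unfold cint01 at 1.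
    rewrite (is_RInt_unique (V := C_R_CompleteNormedModule) _ _ _ _ (H ltac:(lia))). ring.
Qed.

Lemma integrable_U_scal (n : nat) (c : C) (u : C -> C) (z : C) : (1 <= n)%nat ->
  integrable n u ->
  integrable n (fun w => c * u w) /\ U n (fun w => c * u w) z = c * U n u z.
Proof.
  intros Hn Hu.
  assert (H : forall i, (S (S i) <= n)%nat ->
    is_RInt (V := C_R_NormedModule)
      (fun t => (c * u (RtoC t)) * pnk (n - 2) i (RtoC t)) 0 1
      (c * cint01 (fun t => u (RtoC t) * pnk (n - 2) i (RtoC t)))).
  { intros i Hi.
    eapply is_RInt_ext; [|exact (is_RInt_Cmult_l c _ _ _ _
      (RInt_correct (V := C_R_CompleteNormedModule) _ _ _ (Hu i Hi)))].
    intros t _. apply Cmult_assoc. }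
  split; [intros i Hi; eexists; apply H, Hi|].
  destruct n as [|[|l]]; [lia|rewrite !U_1; ring|].
  rewrite !U_SS.
  rewrite (Csum_ext _ (fun i =>
    c * (cint01 (fun t => u (RtoC t) * pnk l i (RtoC t)) * pnk (S (S l)) (S i) z))).
  - rewrite Csum_mult_l. ring.
  - intros i Hi. specialize (H i). replace (S (S l) - 2)%nat with l in H by lia.
    unfold cint01 at 1.
    rewrite (is_RInt_unique (V := C_R_CompleteNormedModule) _ _ _ _ (H ltac:(lia))). ring.
Qed.

Lemma integrable_U_Csum (n m : nat) (u : nat -> C -> C) (z : C) : (1 <= n)%nat ->
  (forall k, integrable n (u k)) ->
  integrable n (fun w => Csum (fun k => u k w) m) /\
  U n (fun w => Csum (fun k => u k w) m) z = Csum (fun k => U n (u k) z) m.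
Proof.
  intros Hn Hu. induction m as [|m [IH1 IH2]]; simpl.
  - split; [apply Hu|reflexivity].
  - destruct (integrable_U_plus n _ (u (S m)) z Hn IH1 (Hu (S m))) as [H1 H2].
    split; [exact H1|]. now rewrite H2, IH2.
Qed.

Lemma Cmod_pnk_le (l i : nat) (t : R) : (0 <= t <= 1)%R ->
  (Cmod (pnk l i (RtoC t)) <= Rabs (Binomial.C l i))%R.
Proof.
  intros Ht. unfold pnk.
  rewrite !Cmod_mult, !Cmod_cpow, <- RtoC_minus, !Cmod_R, Rmult_assoc.
  rewrite <- (Rmult_1_r (Rabs (Binomial.C l i))) at 2.
  apply Rmult_le_compat_l; [apply Rabs_pos|].
  apply Rle_trans with (1 * 1)%R; [|lra].
  rewrite (Rabs_pos_eq t), (Rabs_pos_eq (1 - t)%R) by lra.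
  apply Rmult_le_compat; try (apply pow_le; lra).
  - rewrite <- (pow1 i). apply pow_incr. lra.
  - apply Rle_trans with (1 ^ (l - i))%R; [apply pow_incr; lra|rewrite pow1; lra].
Qed.

(** For fixed [n], [U n h z] depends on [h] only through finitely many integrals over [0,1] and the
    two endpoint values, all of which respect uniform convergence on [0,1]. *)
Lemma U_climit (n : nat) (u : nat -> C -> C) (v : C -> C) (tau : nat -> R) (z : C) :
  (1 <= n)%nat -> (forall m, integrable n (u m)) -> is_lim_seq tau 0 ->
  (forall m t, (0 <= t <= 1)%R -> (Cmod (u m (RtoC t) - v (RtoC t)) <= tau m)%R) ->
  climit (fun m => U n (u m) z) (U n v z).
Proof.
  intros Hn Hu Htau Huv.
  assert (L0 : climit (fun m => u m 0) (v 0)).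
  { apply climit_of_le with tau; [|exact Htau]. intros m. apply Huv. lra. }
  assert (L1 : climit (fun m => u m 1) (v 1)).
  { apply climit_of_le with tau; [|exact Htau]. intros m. apply Huv. lra. }
  destruct n as [|[|l]]; [lia| |].
  - rewrite U_1. apply climit_ext with (fun m => (1 - z) * u m 0 + z * u m 1).
    { intros m. now rewrite U_1. }
    apply climit_plus; apply climit_mult; try assumption; apply climit_const.
  - rewrite U_SS. eapply climit_ext; [intros m; symmetry; apply U_SS|].
    apply climit_plus; [apply climit_plus|].
    2, 3: apply climit_mult; try assumption; apply climit_const.
    apply climit_mult; [apply climit_const|].
    apply climit_Csum. intros i Hi.
    apply climit_mult; [|apply climit_const].
    apply (RInt_climit (fun m t => u m (RtoC t) * pnk l i (RtoC t)) _
      (fun m => tau m * Rabs (Binomial.C l i))%R).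
    + intros m. specialize (Hu m i). replace (S (S l) - 2)%nat with l in Hu by lia.
      apply Hu. lia.
    + rewrite <- (Rmult_0_l (Rabs (Binomial.C l i))).
      apply is_lim_seq_mult'; [exact Htau|apply is_lim_seq_const].
    + intros m t Ht.
      replace (_ - _) with ((u m (RtoC t) - v (RtoC t)) * pnk l i (RtoC t)) by ring.
      rewrite Cmod_mult. apply Rmult_le_compat; try apply Cmod_ge_0.
      * now apply Huv.
      * now apply Cmod_pnk_le.
Qed.

(** * The operator on monomials *)

Lemma rising_fact (i p : nat) :
  rising (INR (S i)) p = (INR (fact (p + i)) / INR (fact i))%R.
Proof.
  revert i; induction p as [|p IH]; intros i.
  - simpl. field. apply INR_fact_neq_0.
  - cbn [rising]. rewrite <- (S_INR (S i)), IH.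
    replace (S p + i)%nat with (p + S i)%nat by lia.
    change (fact (S i)) with (S i * fact i)%nat. rewrite mult_INR.
    field. split; [apply INR_fact_neq_0|apply not_0_INR; lia].
Qed.

(** With [n = l + 2] and [k = i + 1] the value is [(k)_p / (n)_p] over [n - 1], so the prefactor of
    [U n] cancels and the quotient of rising factorials remains. *)
Lemma is_RInt_moment (l i p : nat) : (i <= l)%nat ->
  is_RInt (V := C_R_NormedModule) (fun t => cpow (RtoC t) p * pnk l i (RtoC t)) 0 1
    (RtoC (/ INR (S l) * (rising (INR (S i)) p / rising (INR (S (S l))) p))).
Proof.
  intros Hi.
  assert (H := is_RInt_scal _ _ _ (Binomial.C l i) _ (is_RInt_beta (p + i) (l - i))).
  apply is_RInt_RtoC in H.
  eapply is_RInt_ext; [|replace (RtoC (_ * _)) with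
    (RtoC (scal (Binomial.C l i) (INR (fact (p + i)) * INR (fact (l - i)) /
             INR (fact (p + i + (l - i) + 1)))%R)); [exact H|]].
  - intros t _. unfold pnk. rewrite cpow_RtoC, <- RtoC_minus, !cpow_RtoC, <- !RtoC_mult.
    f_equal. change (Binomial.C l i * (t ^ (p + i) * (1 - t) ^ (l - i))
      = t ^ p * (Binomial.C l i * t ^ i * (1 - t) ^ (l - i)))%R.
    rewrite pow_add. ring.
  - f_equal. rewrite !rising_fact. unfold Binomial.C.
    replace (p + i + (l - i) + 1)%nat with (p + S l)%nat by lia.
    change (INR (fact l) / (INR (fact i) * INR (fact (l - i)))
      * (INR (fact (p + i)) * INR (fact (l - i)) / INR (fact (p + S l)))
      = / INR (S l) * (INR (fact (p + i)) / INR (fact i)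
        / (INR (fact (p + S l)) / INR (fact (S l)))))%R.
    change (fact (S l)) with (S l * fact l)%nat. rewrite mult_INR.
    field. repeat split; try apply INR_fact_neq_0. apply not_0_INR; lia.
Qed.

Lemma integrable_U_monomial (n p : nat) (z : C) : (1 <= n)%nat ->
  integrable n (fun w => cpow w p) /\ U n (fun w => cpow w p) z = walk n p 0 0 z.
Proof.
  intros Hn. split.
  { intros i Hi. eexists. apply is_RInt_moment. lia. }
  assert (Hrise : forall x, (0 < x)%R -> (0 < rising x p)%R).
  { induction p as [|q IH]; simpl; intros x Hx; [lra|].
    apply Rmult_lt_0_compat; [exact Hx|]. apply IH. lra. }
  assert (HnR : (0 < INR n)%R) by (apply lt_0_INR; lia).
  specialize (Hrise _ HnR).
  assert (Hne : RtoC (rising (INR n) p) <> 0).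
  { intros E. apply RtoC_inj in E. lra. }
  (* Clearing the denominator [(n)_p] turns the claim into [bernstein_rising]. *)
  assert (E : U n (fun w => cpow w p) z * RtoC (rising (INR n) p)
              = RtoC (rising (INR n) p) * walk n p 0 0 z).
  2:{ rewrite Cmult_comm in E.
      apply (f_equal (fun x => / RtoC (rising (INR n) p) * x)) in E.
      rewrite !Cmult_assoc, Cinv_l, !Cmult_1_l in E by exact Hne. exact E. }
  rewrite <- bernstein_rising by exact Hn.
  (* The endpoint values fit the interior pattern [(k)_p / (n)_p]: at [k = 0] it equals [0^p],
     including [p = 0], and at [k = n] it equals 1. *)
  assert (E0 : cpow 0 p * RtoC (rising (INR n) p) = RtoC (rising (INR 0) p)).
  { destruct p as [|q]; simpl; [ring|].
    rewrite RtoC_mult with (x := 0%R). ring. }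
  assert (E1 : cpow 1 p = 1) by (rewrite cpow_RtoC, pow1; reflexivity).
  unfold bernstein.
  rewrite (Csum_ext _ (fun k => pnk n k z * RtoC (rising (INR k) p)))
    by (intros k Hk; now rewrite pnk_bern).
  assert (P0 : pnk n 0 z = cpow (1 - z) n).
  { unfold pnk. rewrite C_n_0, Nat.sub_0_r. simpl. ring. }
  assert (Pn : pnk n n z = cpow z n).
  { unfold pnk. rewrite C_n_n, Nat.sub_diag. simpl. ring. }
  destruct n as [|[|l]]; [lia| |].
  - rewrite U_1. cbn [Csum]. rewrite P0, Pn, E1, <- E0. simpl cpow. ring.
  - rewrite U_SS, Csum_split_first.
    cbn [Csum]. rewrite P0, Pn, E1, <- E0.
    rewrite (Csum_ext (fun i => _ * pnk (S (S l)) (S i) z)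
      (fun i => (/ INR (S l) * / rising (INR (S (S l))) p)
        * (pnk (S (S l)) (S i) z * RtoC (rising (INR (S i)) p)))).
    + rewrite Csum_mult_l. field. split; [exact Hne|].
      intros E. apply RtoC_inj in E. revert E. apply not_0_INR. lia.
    + intros i Hi. unfold cint01.
      rewrite (is_RInt_unique (V := C_R_CompleteNormedModule) _ _ _ _ (is_RInt_moment l i p Hi)).
      unfold Rdiv.
      rewrite !RtoC_mult, !RtoC_inv; [ring|now apply Rgt_not_eq|apply not_0_INR; lia].
Qed.

(** * Growth of power series coefficients *)

(** Balls in the uniform structure of C are squares, so passing from a ball to [Cmod] costs a factor
    [sqrt 2]; halving the radius absorbs it. *)
Lemma sqrt_2_lt_2 : (sqrt 2 < 2)%R.
Proof.
  rewrite <- (sqrt_Rsqr 2) at 2 by lra. apply sqrt_lt_1; unfold Rsqr; lra.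
Qed.

Lemma climit_of_series (x : nat -> C) (l : C) :
  is_series (V := C_NormedModule) x l -> climit (Csum x) l.
Proof.
  intros H. apply is_lim_seq_spec. intros eps.
  assert (Heps : (0 < eps / 2)%R) by (destruct eps; simpl; lra).
  destruct (proj1 (filterlim_locally (U := C_UniformSpace) _ _) H (mkposreal _ Heps))
    as [N HN].
  exists N. intros n Hn. specialize (HN n Hn).
  apply C_NormedModule_mixin_compat2 in HN.
  rewrite Rminus_0_r, Rabs_pos_eq by apply Cmod_ge_0.
  rewrite <- Csum_sum_n.
  eapply Rlt_trans; [exact HN|]. simpl.
  assert (H2 := sqrt_2_lt_2).
  destruct eps as [e He]; simpl in *. nra.
Qed.

Lemma climit_bounded (x : nat -> C) (l : C) :
  climit x l -> exists B, forall n, (Cmod (x n) <= B)%R.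
Proof.
  intros H. apply is_lim_seq_Reals in H.
  destruct (maj_by_pos _ (exist _ 0%R H)) as (B & _ & HB).
  exists (B + Cmod l)%R. intros n.
  replace (x n) with ((x n - l) + l) at 1 by ring.
  eapply Rle_trans; [apply Cmod_triangle|]. apply Rplus_le_compat_r.
  eapply Rle_trans; [apply Rle_abs|apply HB].
Qed.

(** For nonnegative [c], this says that the radius of convergence is at least [R0], in the form of
    bounded terms, which survives polynomial weights. *)
Definition tame (R0 : R) (c : nat -> R) : Prop :=
  forall rho, (0 <= rho < R0)%R -> exists B, forall k, (c k * rho ^ k <= B)%R.

Lemma tame_coefficients (R0 : R) (f : C -> C) (a : nat -> C) :
  (forall z : C, (Cmod z < R0)%R ->
    is_series (V := C_NormedModule) (fun k => a k * cpow z k) (f z)) ->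
  tame R0 (fun k => Cmod (a k)).
Proof.
  intros H rho Hrho.
  assert (Hz : Cmod (RtoC rho) = rho) by (rewrite Cmod_R; apply Rabs_pos_eq; lra).
  assert (L := climit_of_series _ _ (H (RtoC rho) ltac:(rewrite Hz; lra))).
  destruct (climit_bounded _ _ L) as [B HB].
  (* Each later term is the difference of two consecutive partial sums, both bounded by [B]. *)
  exists (B + B)%R. intros k.
  rewrite <- Hz at 1. rewrite <- Cmod_cpow, <- Cmod_mult.
  destruct k as [|k].
  - assert (H0 := HB O). cbn [Csum] in H0.
    assert (H1 := Cmod_ge_0 (a O * cpow rho O)). lra.
  - assert (H1 := HB k). assert (H2 := HB (S k)). cbn [Csum] in H2.
    set (s := Csum (fun k => a k * cpow rho k) k) in *.
    replace (a (S k) * cpow rho (S k))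
      with ((s + a (S k) * cpow rho (S k)) + - s) by ring.
    eapply Rle_trans; [apply Cmod_triangle|]. rewrite Cmod_opp.
    now apply Rplus_le_compat.
Qed.

Lemma succ_mult_pow_le (x : R) (k : nat) : (0 <= x < 1)%R ->
  ((INR k + 1) * x ^ k <= / (1 - x))%R.
Proof.
  intros Hx.
  (* Each of the [k + 1] terms of [1 + x + ... + x^k] is at least [x^k]. *)
  assert (H : ((INR k + 1) * x ^ k * (1 - x) <= 1 - x ^ S k)%R).
  { induction k as [|k IH]; [simpl; lra|].
    rewrite S_INR. assert (P : (0 <= x ^ S k <= 1)%R).
    { split; [apply pow_le; lra|]. rewrite <- (pow1 (S k)). apply pow_incr. lra. }
    change (x ^ S (S k))%R with (x * x ^ S k)%R.
    apply (Rmult_le_compat_l x) in IH; [|lra].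
    change (x ^ S k)%R with (x * x ^ k)%R in *. nra. }
  apply Rmult_le_reg_r with (1 - x)%R; [lra|].
  rewrite Rinv_l by lra.
  assert (0 <= x ^ S k)%R by (apply pow_le; lra). lra.
Qed.

(** The room between [rho] and [R0] yields a geometric factor, which absorbs a weight [k + 1] or
    makes bounded terms summable. *)
Lemma pow_ratio (rho R0 : R) : (0 <= rho < R0)%R ->
  exists rho' x, (0 <= rho' < R0)%R /\ (0 <= x < 1)%R /\
    forall k, (rho ^ k = rho' ^ k * x ^ k)%R.
Proof.
  intros H. exists ((rho + R0) / 2)%R, (rho / ((rho + R0) / 2))%R.
  assert (H0 : (0 < (rho + R0) / 2)%R) by lra.
  repeat split; try lra.
  - apply Rdiv_le_0_compat; lra.
  - apply Rmult_lt_reg_r with ((rho + R0) / 2)%R; [exact H0|].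
    unfold Rdiv at 1. rewrite Rmult_assoc, Rinv_l by lra. lra.
  - intros k. rewrite <- Rpow_mult_distr. f_equal. field. lra.
Qed.

Lemma tame_succ_mult (R0 : R) (c : nat -> R) :
  (forall k, (0 <= c k)%R) -> tame R0 c -> tame R0 (fun k => (INR k + 1) * c k)%R.
Proof.
  intros Hc H rho Hrho.
  destruct (pow_ratio rho R0 Hrho) as (rho' & x & Hrho' & Hx & E).
  destruct (H rho' Hrho') as [B HB]. exists (B * / (1 - x))%R. intros k.
  rewrite E.
  replace ((INR k + 1) * c k * (rho' ^ k * x ^ k))%R
    with ((c k * rho' ^ k) * ((INR k + 1) * x ^ k))%R by ring.
  apply Rmult_le_compat; [| |apply HB|now apply succ_mult_pow_le].
  - apply Rmult_le_pos; [apply Hc|apply pow_le; lra].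
  - apply Rmult_le_pos; [assert (H1 := pos_INR k); lra|apply pow_le; lra].
Qed.

Lemma tame_summable (R0 rho : R) (c : nat -> R) :
  (forall k, (0 <= c k)%R) -> tame R0 c -> (0 <= rho < R0)%R ->
  exists s : R, is_lim_seq (sum_f_R0 (fun k => c k * rho ^ k)%R) s /\
    forall n, (sum_f_R0 (fun k => c k * rho ^ k) n <= s)%R.
Proof.
  intros Hc H Hrho.
  destruct (pow_ratio rho R0 Hrho) as (rho' & x & Hrho' & Hx & E).
  destruct (H rho' Hrho') as [B HB].
  assert (Hpos : forall k, (0 <= c k * rho ^ k)%R).
  { intros k. apply Rmult_le_pos; [apply Hc|apply pow_le; lra]. }
  assert (Hex : ex_series (fun k => c k * rho ^ k)%R).
  { apply (ex_series_le (V := R_CompleteNormedModule) _ (fun k => B * x ^ k)%R).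
    - intros k. change (norm (c k * rho ^ k)%R) with (Rabs (c k * rho ^ k)).
      rewrite Rabs_pos_eq by apply Hpos. rewrite E, <- Rmult_assoc.
      apply Rmult_le_compat_r; [apply pow_le; lra|apply HB].
    - apply (ex_series_scal_l (V := R_NormedModule) B), ex_series_geom.
      rewrite Rabs_pos_eq; lra. }
  destruct Hex as [s Hs]. exists s.
  assert (L : is_lim_seq (sum_f_R0 (fun k => c k * rho ^ k)%R) s).
  { apply is_lim_seq_ext with (2 := Hs). intros n. apply sum_n_Reals. }
  split; [exact L|]. apply is_lim_seq_incr_compare; [exact L|].
  intros n. simpl. specialize (Hpos (S n)). simpl in Hpos. lra.
Qed.

Lemma Cmod_Csum_tail (x : nat -> C) (l : C) (y : nat -> R) (s : R) (m : nat) :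
  (forall k, (Cmod (x k) <= y k)%R) -> climit (Csum x) l ->
  (forall n, (sum_f_R0 y n <= s)%R) ->
  (Cmod (Csum x m - l) <= s - sum_f_R0 y m)%R.
Proof.
  intros Hxy Hl Hs.
  replace (Csum x m - l) with (- (l + - Csum x m)) by ring. rewrite Cmod_opp.
  apply (Cmod_climit_le (fun n => Csum x n + - Csum x m) _ _ m).
  - intros n Hn.
    apply Rle_trans with (sum_f_R0 y n - sum_f_R0 y m)%R; [|specialize (Hs n); lra].
    induction Hn as [|n Hn IH].
    + replace (Csum x m + - Csum x m) with (RtoC 0) by ring. rewrite Cmod_0. lra.
    + simpl. replace (Csum x n + x (S n) + - Csum x m)
        with ((Csum x n + - Csum x m) + x (S n)) by ring.
      eapply Rle_trans; [apply Cmod_triangle|]. specialize (Hxy (S n)). lra.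
  - apply climit_plus; [exact Hl|apply climit_const].
Qed.

(** * Termwise differentiation *)

(** The remainder for [S k] is [w] times that for [k] plus [(w - z)^2 * k * z^(k-1)]; the generous
    factor [k^2] closes the induction. *)
Lemma Cmod_cpow_taylor (w z : C) (rho : R) (k : nat) :
  (1 <= rho)%R -> (Cmod w <= rho)%R -> (Cmod z <= rho)%R ->
  (Cmod (cpow w k - cpow z k - (w - z) * (INR k * cpow z (k - 1)))
   <= Cmod (w - z) ^ 2 * (INR k ^ 2 * rho ^ k))%R.
Proof.
  intros Hr Hw Hz. induction k as [|k IH].
  - simpl. replace (1 - 1 - (w - z) * (0 * 1)) with (RtoC 0) by ring.
    rewrite Cmod_0. lra.
  - replace (S k - 1)%nat with k by lia.
    replace (cpow w (S k) - cpow z (S k) - (w - z) * (INR (S k) * cpow z k))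
      with (w * (cpow w k - cpow z k - (w - z) * (INR k * cpow z (k - 1)))
            + (w - z) * (w - z) * (INR k * cpow z (k - 1))).
    2:{ rewrite S_INR, RtoC_plus. destruct k as [|k].
        - simpl. ring.
        - replace (S k - 1)%nat with k by lia. simpl cpow. ring. }
    eapply Rle_trans; [apply Cmod_triangle|].
    rewrite !Cmod_mult. set (D := Cmod (w - z)) in *.
    rewrite (Cmod_R (INR k)), Rabs_pos_eq by apply pos_INR.
    assert (H1 : (Cmod (cpow z (k - 1)) <= rho ^ k)%R) by (apply Cmod_cpow_le; auto; lia).
    assert (HD : (0 <= D)%R) by apply Cmod_ge_0.
    assert (Hk := pos_INR k).
    assert (Hp : (1 <= rho ^ k)%R) by now apply pow_R1_Rle.
    apply Rle_trans with (rho * (D ^ 2 * (INR k ^ 2 * rho ^ k))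
                          + D * D * (INR k * rho ^ k))%R.
    + apply Rplus_le_compat.
      * apply Rmult_le_compat; auto; apply Cmod_ge_0.
      * apply Rmult_le_compat_l; [nra|]. now apply Rmult_le_compat_l.
    + rewrite S_INR. change (rho ^ S k)%R with (rho * rho ^ k)%R.
      apply Rminus_le_0.
      replace (_ - _)%R with (D ^ 2 * (rho ^ k * (2 * INR k * rho + rho - INR k)))%R by ring.
      apply Rmult_le_pos; [apply pow2_ge_0|]. apply Rmult_le_pos; [lra|nra].
Qed.

Lemma C_derive_of_quadratic_remainder (f : C -> C) (z L : C) (delta K : R) :
  (0 < delta)%R ->
  (forall w, (Cmod (w - z) < delta)%R ->
    (Cmod (f w - f z - (w - z) * L) <= Cmod (w - z) ^ 2 * K)%R) ->
  C_derive f z = L.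
Proof.
  intros Hd H. unfold C_derive. apply is_C_lim_unique.
  apply filterlim_locally. intros eps.
  (* [Rabs K + 1] is a positive majorant of [K], whose sign is not assumed. *)
  assert (HK : (0 < Rabs K + 1)%R) by (assert (H0 := Rabs_pos K); lra).
  set (d := Rmin delta (eps / (Rabs K + 1))).
  assert (Hdpos : (0 < d)%R).
  { apply Rmin_glb_lt; [exact Hd|]. apply Rdiv_lt_0_compat; [apply eps|exact HK]. }
  assert (Hd2 : (0 < d / 2)%R) by lra.
  exists (mkposreal _ Hd2). intros w Hw Hne.
  apply C_NormedModule_mixin_compat2 in Hw.
  assert (Hwz : (Cmod (w - z) < d)%R).
  { eapply Rlt_trans; [exact Hw|]. simpl.
    assert (H2 := sqrt_2_lt_2).
    nra. }
  assert (Hnz : w - z <> 0).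
  { intros E. apply Hne. change (@eq C w z). replace w with ((w - z) + z) by ring. rewrite E. ring. }
  assert (Hpos := proj1 (Cmod_gt_0 _) Hnz).
  apply C_NormedModule_mixin_compat1.
  change (Cmod ((f w - f z) / (w - z) - L) < eps)%R.
  replace ((f w - f z) / (w - z) - L) with ((f w - f z - (w - z) * L) / (w - z))
    by (field; exact Hnz).
  rewrite Cmod_div by exact Hnz.
  apply Rmult_lt_reg_r with (Cmod (w - z)); [exact Hpos|].
  unfold Rdiv. rewrite Rmult_assoc, Rinv_l, Rmult_1_r by lra.
  eapply Rle_lt_trans.
  { apply H. eapply Rlt_le_trans; [exact Hwz|apply Rmin_l]. }
  assert (Hlt : (Cmod (w - z) * (Rabs K + 1) < eps)%R).
  { apply Rlt_le_trans with (eps / (Rabs K + 1) * (Rabs K + 1))%R.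
    - apply Rmult_lt_compat_r; [exact HK|].
      eapply Rlt_le_trans; [exact Hwz|apply Rmin_r].
    - right. field. lra. }
  assert (HKa := Rle_abs K).
  assert (Cmod (w - z) * K <= Cmod (w - z) * (Rabs K + 1))%R.
  { apply Rmult_le_compat_l; lra. }
  replace (Cmod (w - z) ^ 2 * K)%R with ((Cmod (w - z) * K) * Cmod (w - z))%R by ring.
  apply Rmult_lt_compat_r; lra.
Qed.

Definition psum (a : nat -> C) (m : nat) (z : C) : C :=
  Csum (fun k => a k * cpow z k) m.

Definition dpsum (a : nat -> C) (m : nat) (z : C) : C :=
  Csum (fun k => a k * (INR k * cpow z (k - 1))) m.

(** The weight [(k + 1)^4], dictated by the monomial error, also covers the degrees 0, 1 and 2 met
    in values, derivatives and Taylor remainders. *)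
Lemma weight_ge (k d : nat) : (d <= 4)%nat -> (INR k ^ d <= (INR k + 1) ^ 4)%R.
Proof.
  intros Hd. assert (H := pos_INR k).
  apply Rle_trans with ((INR k + 1) ^ d)%R.
  - apply pow_incr. lra.
  - apply Rle_pow; [lra|lia].
Qed.

(** The Taylor remainders of all partial sums obey one quadratic bound, with constant the weighted
    sum [s]. The bound passes to the limit and identifies the derivative. *)
Lemma C_derive_power_series (R0 r : R) (f : C -> C) (a : nat -> C) (z : C) :
  (1 <= r)%R -> (r < R0)%R -> tame R0 (fun k => (INR k + 1) ^ 4 * Cmod (a k))%R ->
  (forall w : C, (Cmod w < R0)%R -> climit (fun m => psum a m w) (f w)) ->
  (Cmod z <= r)%R ->
  climit (fun m => dpsum a m z) (C_derive f z).
Proof.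
  intros Hr HR Ht Hf Hz.
  assert (Hpos : forall k, (0 <= (INR k + 1) ^ 4 * Cmod (a k))%R).
  { intros k. apply Rmult_le_pos; [apply pow_le|apply Cmod_ge_0].
    assert (H := pos_INR k). lra. }
  (* A radius beyond [r] keeps every [w] within [rho - r] of [z] in a disk where the series is
     controlled. *)
  set (rho := ((r + R0) / 2)%R).
  assert (Hrho : (r < rho < R0)%R) by (unfold rho; lra).
  destruct (tame_summable R0 rho _ Hpos Ht) as (s & Ls & Hs); [lra|].
  assert (HL : exists L, climit (fun m => dpsum a m z) L).
  { destruct (ex_series_le (V := C_CompleteNormedModule)
      (fun k => a k * (INR k * cpow z (k - 1))) (fun k => (INR k + 1) ^ 4 * Cmod (a k) * rho ^ k)%R)
      as [L HL].
    - intros k.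
      change (Cmod (a k * (INR k * cpow z (k - 1)))
              <= (INR k + 1) ^ 4 * Cmod (a k) * rho ^ k)%R.
      rewrite !Cmod_mult, Cmod_R, Rabs_pos_eq by apply pos_INR.
      replace ((INR k + 1) ^ 4 * Cmod (a k) * rho ^ k)%R
        with (Cmod (a k) * ((INR k + 1) ^ 4 * rho ^ k))%R by ring.
      apply Rmult_le_compat_l; [apply Cmod_ge_0|].
      apply Rmult_le_compat; [apply pos_INR|apply Cmod_ge_0| |].
      + rewrite <- (pow_1 (INR k)) at 1. apply weight_ge. lia.
      + apply Cmod_cpow_le; [lra|lra|lia].
    - exists s. apply (is_lim_seq_ext _ _ s (fun n => eq_sym (sum_n_Reals _ n)) Ls).
    - exists L. apply climit_of_series, HL. }
  destruct HL as [L HL].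
  enough (E : C_derive f z = L) by now rewrite E.
  apply C_derive_of_quadratic_remainder with (rho - r)%R s; [lra|].
  intros w Hw.
  assert (Hwr : (Cmod w <= rho)%R).
  { replace w with ((w - z) + z) by ring.
    eapply Rle_trans; [apply Cmod_triangle|]. lra. }
  apply (Cmod_climit_le (fun m => psum a m w + - psum a m z + - ((w - z) * dpsum a m z)) _ _ 0).
  - intros m _. unfold psum, dpsum.
    replace (Csum (fun k => a k * cpow w k) m + - Csum (fun k => a k * cpow z k) m
             + - ((w - z) * Csum (fun k => a k * (INR k * cpow z (k - 1))) m))
      with (Csum (fun k => a k * (cpow w k - cpow z k
              - (w - z) * (INR k * cpow z (k - 1)))) m).
    2:{ induction m as [|m IH]; cbn [Csum]; [ring|]. rewrite IH. ring. }
    eapply Rle_trans.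
    { apply Cmod_Csum_le with
        (y := fun k => ((INR k + 1) ^ 4 * Cmod (a k) * rho ^ k * Cmod (w - z) ^ 2)%R).
      intros k _. rewrite Cmod_mult.
      replace ((INR k + 1) ^ 4 * Cmod (a k) * rho ^ k * Cmod (w - z) ^ 2)%R
        with (Cmod (a k) * (Cmod (w - z) ^ 2 * ((INR k + 1) ^ 4 * rho ^ k)))%R by ring.
      apply Rmult_le_compat_l; [apply Cmod_ge_0|].
      eapply Rle_trans; [apply Cmod_cpow_taylor with (rho := rho); lra|].
      apply Rmult_le_compat_l; [apply pow2_ge_0|].
      apply Rmult_le_compat_r; [apply pow_le; lra|]. apply weight_ge. lia. }
    rewrite <- scal_sum. apply Rmult_le_compat_l; [apply pow2_ge_0|apply Hs].
  - apply climit_plus; [apply climit_plus|].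
    + apply Hf. lra.
    + apply climit_opp, Hf. lra.
    + apply climit_opp, climit_mult; [apply climit_const|exact HL].
Qed.

Lemma power_series_bounds (R0 r : R) (f : C -> C) (a : nat -> C) :
  (1 <= r)%R -> (r < R0)%R ->
  (forall z : C, (Cmod z < R0)%R ->
    is_series (V := C_NormedModule) (fun k => a k * cpow z k) (f z)) ->
  exists (s : R) (tau : nat -> R),
    (forall m, (sum_f_R0 (fun k => (INR k + 1) ^ 4 * Cmod (a k) * r ^ k) m <= s)%R) /\
    is_lim_seq tau 0 /\
    (forall m t, (0 <= t <= 1)%R ->
      (Cmod (psum a m (RtoC t)) <= s)%R /\ (Cmod (f (RtoC t)) <= s)%R /\
      (Cmod (psum a m (RtoC t) - f (RtoC t)) <= tau m)%R) /\
    (forall z, (Cmod z <= r)%R -> climit (fun m => dpsum a m z) (C_derive f z)).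
Proof.
  intros Hr HR Hf.
  assert (Hpos : forall k, (0 <= (INR k + 1) ^ 4 * Cmod (a k))%R).
  { intros k. apply Rmult_le_pos; [apply pow_le|apply Cmod_ge_0].
    assert (H := pos_INR k). lra. }
  assert (Ht : tame R0 (fun k => (INR k + 1) ^ 4 * Cmod (a k))%R).
  { assert (T0 := tame_coefficients R0 f a Hf).
    assert (HC : forall k, (0 <= Cmod (a k))%R) by (intros; apply Cmod_ge_0).
    assert (Hk : forall k, (0 <= INR k + 1)%R) by (intros k; assert (H := pos_INR k); lra).
    assert (T1 := tame_succ_mult _ _ HC T0).
    assert (HC1 := fun k => Rmult_le_pos _ _ (Hk k) (HC k)).
    assert (T2 := tame_succ_mult _ _ HC1 T1).
    assert (HC2 := fun k => Rmult_le_pos _ _ (Hk k) (HC1 k)).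
    assert (T3 := tame_succ_mult _ _ HC2 T2).
    assert (HC3 := fun k => Rmult_le_pos _ _ (Hk k) (HC2 k)).
    assert (T4 := tame_succ_mult _ _ HC3 T3).
    intros rho Hrho. destruct (T4 rho Hrho) as [B HB]. exists B. intros k.
    eapply Rle_trans; [|apply (HB k)]. right. ring. }
  assert (Hl : forall w : C, (Cmod w < R0)%R -> climit (fun m => psum a m w) (f w)).
  { intros w Hw. apply climit_of_series, Hf, Hw. }
  destruct (tame_summable R0 r _ Hpos Ht) as (s & Ls & Hs); [lra|].
  (* [s] is the full weighted sum at radius [r] and [tau] its tail; since [r] is at least 1, they
     also control values and tails on [0,1]. *)
  exists s, (fun m => s - sum_f_R0 (fun k => (INR k + 1) ^ 4 * Cmod (a k) * r ^ k) m)%R.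
  split; [exact Hs|]. split; [|split].
  - replace (Finite 0) with (Finite (s - s)) by (f_equal; ring).
    apply is_lim_seq_minus'; [apply is_lim_seq_const|exact Ls].
  - intros m t Htt.
    assert (Hterm : forall k, (Cmod (a k * cpow (RtoC t) k)
      <= (INR k + 1) ^ 4 * Cmod (a k) * r ^ k)%R).
    { intros k. rewrite Cmod_mult.
      rewrite <- (Rmult_1_l (Cmod (a k) * _)), Rmult_assoc.
      apply Rmult_le_compat; [lra| | |].
      - apply Rmult_le_pos; apply Cmod_ge_0.
      - apply (weight_ge k 0). lia.
      - apply Rmult_le_compat_l; [apply Cmod_ge_0|].
        apply Cmod_cpow_le; [exact Hr| |lia].
        rewrite Cmod_R, Rabs_pos_eq; lra. }
    assert (Hlt : climit (fun m => psum a m (RtoC t)) (f (RtoC t))).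
    { apply Hl. rewrite Cmod_R, Rabs_pos_eq; lra. }
    assert (Hps : forall m, (Cmod (psum a m (RtoC t)) <= s)%R).
    { intros m'. eapply Rle_trans; [|apply (Hs m')]. apply Cmod_Csum_le. auto. }
    split; [apply Hps|split].
    + apply (Cmod_climit_le _ _ _ 0 (fun m _ => Hps m) Hlt).
    + now apply Cmod_Csum_tail.
  - intros z Hz. now apply C_derive_power_series with R0 r.
Qed.

(** * The error for partial sums and the passage to the limit *)

Lemma integrable_U_psum (n m : nat) (a : nat -> C) (z : C) : (1 <= n)%nat ->
  integrable n (psum a m) /\
  U n (psum a m) z = Csum (fun k => a k * walk n k 0 0 z) m.
Proof.
  intros Hn. unfold psum.
  assert (H : forall k, integrable n (fun w => a k * cpow w k)).
  { intros k. apply (integrable_U_scal n (a k) _ z Hn), (integrable_U_monomial n k z Hn). }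
  destruct (integrable_U_Csum n m (fun k w => a k * cpow w k) z Hn H) as [H1 H2].
  split; [exact H1|]. rewrite H2. apply Csum_ext. intros k _.
  destruct (integrable_U_monomial n k z Hn) as [H3 H4].
  destruct (integrable_U_scal n (a k) _ z Hn H3) as [_ ->]. now rewrite H4.
Qed.

Lemma integrable_U_psum_mult (n m : nat) (a b : nat -> C) (z : C) : (1 <= n)%nat ->
  integrable n (fun w => psum a m w * psum b m w) /\
  U n (fun w => psum a m w * psum b m w) z
  = Csum (fun j => Csum (fun k => a j * b k * walk n (j + k) 0 0 z) m) m.
Proof.
  intros Hn.
  replace (fun w => psum a m w * psum b m w)
    with (fun w => Csum (fun j => Csum (fun k => a j * b k * cpow w (j + k)) m) m).
  2:{ apply functional_extensionality. intros w. unfold psum. rewrite Csum_mult.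
      apply Csum_ext. intros j _. apply Csum_ext. intros k _. rewrite cpow_add. ring. }
  assert (H : forall j k, integrable n (fun w => a j * b k * cpow w (j + k)) /\
    U n (fun w => a j * b k * cpow w (j + k)) z = a j * b k * walk n (j + k) 0 0 z).
  { intros j k. destruct (integrable_U_monomial n (j + k) z Hn) as [H3 H4].
    destruct (integrable_U_scal n (a j * b k) _ z Hn H3) as [H5 H6].
    split; [exact H5|]. now rewrite H6, H4. }
  assert (H' := fun j => integrable_U_Csum n m (fun k w => a j * b k * cpow w (j + k)) z Hn
                  (fun k => proj1 (H j k))).
  destruct (integrable_U_Csum n m
    (fun j w => Csum (fun k => a j * b k * cpow w (j + k)) m) z Hn (fun j => proj1 (H' j)))
    as [H1 H2].
  split; [exact H1|]. rewrite H2. apply Csum_ext. intros j _.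
  rewrite (proj2 (H' j)). apply Csum_ext. intros k _. apply H.
Qed.

Lemma psum_error (n m : nat) (a b : nat -> C) (z : C) : (1 <= n)%nat ->
  U n (fun w => psum a m w * psum b m w) z + - (U n (psum a m) z * U n (psum b m) z)
  + - (2 * z * (1 - z) * dpsum a m z * dpsum b m z * / INR n)
  = Csum (fun j => Csum (fun k => a j * b k * monomial_error n j k z) m) m.
Proof.
  intros Hn.
  rewrite (proj2 (integrable_U_psum_mult n m a b z Hn)).
  rewrite !(proj2 (integrable_U_psum n m _ z Hn)).
  replace (2 * z * (1 - z) * dpsum a m z * dpsum b m z * / INR n)
    with ((2 * z * (1 - z) * / INR n) * (dpsum a m z * dpsum b m z)) by ring.
  unfold dpsum. rewrite !Csum_mult, <- Csum_mult_l.
  assert (Hopp : forall x, - Csum x m = Csum (fun k => - (1) * x k) m).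
  { intros x. rewrite Csum_mult_l. ring. }
  rewrite !Hopp, <- !Csum_plus. apply Csum_ext. intros j _.
  rewrite <- !Csum_mult_l, <- !Csum_plus. apply Csum_ext. intros k _.
  unfold monomial_error, Cdiv. ring.
Qed.

(** The bound on [monomial_error] is a product of a factor in [j] and one in [k], so the double sum
    is dominated by the product of the two weighted sums, uniformly in [m]. *)
Lemma Cmod_psum_error (n m : nat) (a b : nat -> C) (z : C) (r sa sb : R) :
  (1 <= r)%R -> (Cmod z <= r)%R -> (1 <= n)%nat ->
  (sum_f_R0 (fun k => (INR k + 1) ^ 4 * Cmod (a k) * r ^ k) m <= sa)%R ->
  (sum_f_R0 (fun k => (INR k + 1) ^ 4 * Cmod (b k) * r ^ k) m <= sb)%R ->
  (Cmod (Csum (fun j => Csum (fun k => (a j * b k * monomial_error n j k z)%C) m) m)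
   <= 64 * sa * sb / INR n ^ 2)%R.
Proof.
  intros Hr Hz Hn Ha Hb.
  assert (Hu : (0 < / INR n ^ 2)%R) by (apply Rinv_0_lt_compat, pow_lt, lt_0_INR; lia).
  assert (Hpos : forall (c : nat -> C) k, (0 <= (INR k + 1) ^ 4 * Cmod (c k) * r ^ k)%R).
  { intros c k. assert (H := pos_INR k).
    repeat apply Rmult_le_pos; try lra; try apply Cmod_ge_0. apply pow_le; lra. }
  set (wa := fun k => ((INR k + 1) ^ 4 * Cmod (a k) * r ^ k)%R) in *.
  set (wb := fun k => ((INR k + 1) ^ 4 * Cmod (b k) * r ^ k)%R) in *.
  assert (Hsb : (0 <= sb)%R).
  { eapply Rle_trans; [|exact Hb]. apply cond_pos_sum. intros k. apply Hpos. }
  assert (Hinner : forall j, (j <= m)%nat ->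
    (Cmod (Csum (fun k => (a j * b k * monomial_error n j k z)%C) m)
     <= wa j * (64 * sb / INR n ^ 2))%R).
  { intros j _. eapply Rle_trans.
    - apply Cmod_Csum_le with (y := fun k => (wb k * (64 * wa j / INR n ^ 2))%R).
      intros k _. rewrite !Cmod_mult.
      eapply Rle_trans.
      + apply Rmult_le_compat_l; [apply Rmult_le_pos; apply Cmod_ge_0|].
        now apply Cmod_monomial_error with (r := r).
      + right. unfold wa, wb, Rdiv. ring.
    - rewrite <- scal_sum.
      replace (wa j * (64 * sb / INR n ^ 2))%R
        with (64 * wa j / INR n ^ 2 * sb)%R by (unfold Rdiv; ring).
      apply Rmult_le_compat_l; [|exact Hb].
      assert (H := Hpos a j). fold (wa j) in H.
      unfold Rdiv. apply Rmult_le_pos; lra. }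
  eapply Rle_trans; [apply Cmod_Csum_le, Hinner|].
  rewrite <- scal_sum.
  replace (64 * sa * sb / INR n ^ 2)%R with (64 * sb / INR n ^ 2 * sa)%R
    by (unfold Rdiv; ring).
  apply Rmult_le_compat_l; [|exact Ha].
  unfold Rdiv. apply Rmult_le_pos; lra.
Qed.

Theorem theorem5p2 (R0 r : R) (f g : C -> C) (a b : nat -> C) :
  (1 <= r)%R -> (r < R0)%R ->
  (forall z : C, (Cmod z < R0)%R -> is_series (V := C_NormedModule) (fun k => a k * cpow z k) (f z)) ->
  (forall z : C, (Cmod z < R0)%R -> is_series (V := C_NormedModule) (fun k => b k * cpow z k) (g z)) ->
  exists Cst : R, forall (n : nat) (z : C), (1 <= n)%nat -> (Cmod z <= r)%R ->
    (Cmod ((U n (fun w => f w * g w) z - U n f z * U n g z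
           - 2 * z * (1 - z) * C_derive f z * C_derive g z / RtoC (INR n))%C)
     <= Cst / (INR n ^ 2))%R.
Proof.
  intros Hr HR Hf Hg.
  destruct (power_series_bounds R0 r f a Hr HR Hf) as (sa & ta & Ha1 & Ha2 & Ha3 & Ha4).
  destruct (power_series_bounds R0 r g b Hr HR Hg) as (sb & tb & Hb1 & Hb2 & Hb3 & Hb4).
  (* The factor 64 is that of [Cmod_monomial_error]. The limit in [m] is taken for fixed [n] and
     [z], so no uniformity in [n] is asked of it. *)
  exists (64 * sa * sb)%R. intros n z Hn Hz.
  apply (Cmod_climit_le (fun m =>
    U n (fun w => psum a m w * psum b m w) z + - (U n (psum a m) z * U n (psum b m) z)
    + - (2 * z * (1 - z) * dpsum a m z * dpsum b m z * / INR n)) _ _ 0).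
  - intros m _. rewrite psum_error by exact Hn.
    now apply Cmod_psum_error with r.
  - apply climit_plus; [apply climit_plus|]; [|apply climit_opp..].
    (* The products converge uniformly on [0,1]: changing one factor at a time costs a tail times
       the bound on the other factor. *)
    + apply U_climit with (fun m => sa * tb m + ta m * sb)%R; [exact Hn| | |].
      * intros m. apply (integrable_U_psum_mult n m a b z Hn).
      * replace (Finite 0) with (Finite (sa * 0 + 0 * sb)) by (f_equal; ring).
        apply is_lim_seq_plus'; apply is_lim_seq_mult'; try assumption;
          apply is_lim_seq_const.
      * intros m t Ht.
        destruct (Ha3 m t Ht) as (A1 & A2 & A3). destruct (Hb3 m t Ht) as (B1 & B2 & B3).
        replace (_ - _) with (psum a m (RtoC t) * (psum b m (RtoC t) - g (RtoC t))
          + (psum a m (RtoC t) - f (RtoC t)) * g (RtoC t)) by ring.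
        eapply Rle_trans; [apply Cmod_triangle|]. rewrite !Cmod_mult.
        apply Rplus_le_compat; apply Rmult_le_compat; try assumption; apply Cmod_ge_0.
    + apply climit_mult; (eapply U_climit; [exact Hn|intros m; now apply integrable_U_psum| |]).
      * exact Ha2.
      * intros m t Ht. now apply Ha3.
      * exact Hb2.
      * intros m t Ht. now apply Hb3.
    + repeat apply climit_mult; try apply climit_const; auto.
Qed.
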